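(* For $b>0$ let $f_b\colon[0,1]\to[0,1]$ be given by $f_b(x)=1-2^{2^b}|x-1/2|^{|x-1/2|^{-b}}$ for $x\ne1/2$ and $f_b(1/2)=1$. The acip of $f_b$, $b<1$, converges weakly to $\delta_0$ as $b\nearrow1$.
   Context: An acip of $f_b$ is an $f_b$-invariant Borel probability measure on $[0,1]$ absolutely continuous with respect to Lebesgue measure. For $b\ge1/\sqrt6$ the map $f_b$ has negative Schwarzian derivative, and it has an acip if and only if $b<1$, in which case the acip is unique; only $b\in[1/\sqrt6,1)$ matters for the limit. $\delta_0$ is the Dirac measure at $0$. *)

(* Defs.v *)
From HB Require Import structures.
From mathcomp Require Import all_boot all_order all_algebra.
From mathcomp Require Import all_classical all_reals all_analysis.
Set Implicit Arguments.
Unset Strict Implicit.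
Unset Printing Implicit Defensive.
Import Order.TTheory GRing.Theory Num.Theory.
Import numFieldNormedType.Exports.
Local Open Scope classical_set_scope.
Local Open Scope ring_scope.

(* [0, 1]-valued maps and Borel probability measures on [0, 1] are handled in
   the ambient line: a Borel probability measure on [0, 1] is a Borel
   probability measure on R giving full mass to `[0, 1], and only the values
   of a map on `[0, 1] matter. *)

Definition flat_map (R : realType) (b x : R) : R :=
  if x == 2^-1 then 1
  else 1 - 2 `^ (2 `^ b) * `|x - 2^-1| `^ (`|x - 2^-1| `^ (- b)).

Definition supported_on (R : realType) (D : set R)
    (mu : probability (measurableTypeR R) R) : Prop :=
  mu D = 1%E.

Definition invariant_on (R : realType) (D : set R) (f : R -> R)
    (mu : probability (measurableTypeR R) R) : Prop :=
  forall A : set R, measurable A -> A `<=` D -> mu (D `&` f @^-1` A) = mu A.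

Definition is_acip (R : realType) (f : R -> R)
    (mu : probability (measurableTypeR R) R) : Prop :=
  [/\ supported_on `[0, 1] mu,
      invariant_on `[0, 1] f mu
    & mu `<< @lebesgue_measure R].

(* No boundedness is required of the test functions: `[0, 1] is compact. *)
Definition weakly_cvg01 (R : realType) (I : Type) (F : set_system I)
    (mu : I -> probability (measurableTypeR R) R)
    (nu : probability (measurableTypeR R) R) : Prop :=
  forall phi : R -> R, {within `[0, 1], continuous phi} ->
    (\int[mu i]_(x in `[0, 1]) phi x) @[i --> F]
      --> \int[nu]_(x in `[0, 1]) phi x.

(* Main.v *)
Require Import Defs.
From mathcomp Require Import all_boot all_order all_algebra.
From mathcomp Require Import ring lra.
From mathcomp Require Import all_classical all_reals all_analysis.
From mathcomp Require Import measurable_realfun.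
Import Order.TTheory GRing.Theory Num.Theory.
Import numFieldNormedType.Exports.
Local Open Scope classical_set_scope.
Local Open Scope ring_scope.

(** The point 0 is a repelling fixed point of [f = f_b], the critical point
    1/2 is mapped to 1 and then to 0, and the closer [b] is to 1 the flatter
    [f] is at 1/2: orbits that pass near 1/2 spend a long time near 0.  It has
    to be shown that an acip charges each small neighbourhood of 1/2 enough
    for these excursions to carry almost all of the mass.

    The lower bound on the mass near 1/2 is a Harnack inequality
    ([mass_harnack]): for intervals [[u, v]] inside [[c, d]], with [c > 0] and
    [d < 1], the ratio of the masses is at least the ratio of the lengths up
    to a factor that depends on [c] and [d] alone, not on [b] nor on the acip.
    It rests on two estimates for the inverse [left_pre] of the left branch of
    [f], both expressed through the log-odds [logit x = ln (x / (1 - x))],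
    whose increment over an interval is its hyperbolic length in (0, 1).
    First, taking preimages shortens hyperbolic length, with a definite gain
    ([left_pre_contraction]).  Secondly, the distortion of a preimage is paid
    for by that gain ([left_pre_distortion]), so that along any sequence of
    preimages the total distortion is bounded by the initial hyperbolic
    length.  The same gain forces all [n]-fold preimages of [[c, d]] to become
    uniformly short as [n] grows ([contracting_left_pre]).  Since the density
    of the acip is close in mean to a continuous function, mass is nearly
    proportional to length in most of these short intervals
    ([ac_oscillation]), and by invariance the proportionality is transported
    back to [[c, d]] with bounded loss ([harnack_pullback]).

    For the escape of mass, let [a_k] be the [k]-th left preimage of 1/2.  The
    preimage of [[0, a_k]] is [[0, a_(k+1)]] together with an interval at 1,
    whose own preimage is an interval around 1/2.  By invariance the mass of
    the latter is the difference of the masses of [[0, a_k]] and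
    [[0, a_(k+1)]], so that these masses sum to at most 1
    ([sum_mass_gates]).  The intervals have length of order at least [1 / k]
    for [k < N] once [b] is close enough to 1, depending on [N]
    ([gate_width]).  With the Harnack inequality, the mass of
    [[eps, 1 - eps]] times the [N]-th harmonic sum is bounded, and it tends to
    0 because the harmonic series diverges ([mass_middle_le]).  The mass near
    1 comes from a neighbourhood of 1/2, hence tends to 0 as well. *)

(** * Elementary calculus *)

Lemma is_derive_within_continuous {R : realType} (f df : R -> R) (a b : R) :
  (forall x, a <= x <= b -> is_derive x 1 f (df x)) ->
  {within `[a, b], continuous f}.
Proof.
move=> fdf; apply: derivable_within_continuous => x.
by rewrite in_itv/= => /fdf[].
Qed.

Lemma le_of_derive_ge0 {R : realType} (f df : R -> R) (a b : R) : a <= b ->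
  (forall x, a <= x <= b -> is_derive x 1 f (df x)) ->
  (forall x, a <= x <= b -> 0 <= df x) -> f a <= f b.
Proof.
move=> ab fdf df0.
have [|c] := @MVT_segment R f df a b ab _ (is_derive_within_continuous _ _ _ _ fdf).
  by move=> x; rewrite in_itv/= => /andP[/ltW ax /ltW xb]; apply: fdf; rewrite ax.
rewrite in_itv/= => /df0 dc0 fE.
by rewrite -subr_ge0 fE mulr_ge0// subr_ge0.
Qed.

Section elementary.
Context {R : realType}.
Implicit Types u r : R.

Lemma ln2_gt0 : 0 < ln 2 :> R.
Proof. by apply: ln_gt0; rewrite ltr1n. Qed.

(** The inequality [tanh (u / 2) <= u / 2], with denominators cleared. *)
Lemma expRN_gap u : 0 <= u -> 2 * (1 - expR (- u)) <= u * (1 + expR (- u)).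
Proof.
move=> u0.
pose k (x : R) := x * (1 + expR (- x)) - 2 * (1 - expR (- x)).
pose dk (x : R) := 1 - expR (- x) * (1 + x).
suff : k 0 <= k u by rewrite /k oppr0 expR0; lra.
apply: (@le_of_derive_ge0 _ k dk) => // x /andP[x0 _].
  rewrite /k; apply: is_derive_eq; rewrite /dk /GRing.scale/=; ring.
rewrite /dk subr_ge0 expRN mulrC ler_pdivrMr ?expR_gt0// mul1r.
exact: expR_ge1Dx.
Qed.

(** The inequality [u <= sinh u], multiplied by [2 * expR (- u)]. *)
Lemma sinh_ge_id u : 0 <= u -> 2 * u * expR (- u) <= 1 - expR (- u) ^+ 2.
Proof.
move=> u0.
pose k (x : R) := expR x - expR (- x) - 2 * x.
pose dk (x : R) := expR x + expR (- x) - 2.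
have : k 0 <= k u.
  apply: (@le_of_derive_ge0 _ k dk) => // x /andP[x0 _].
    rewrite /k; apply: is_derive_eq; rewrite /dk /GRing.scale/=; ring.
  rewrite /dk expRN; have := expR_gt0 x; set e := expR x => e0.
  have -> : e + e^-1 - 2 = (e - 1) ^+ 2 / e by field; lra.
  by rewrite divr_ge0 ?sqr_ge0// ltW.
rewrite /k oppr0 expR0 subrr mulr0 subrr => ku.
rewrite -subr_ge0.
have -> : 1 - expR (- u) ^+ 2 - 2 * u * expR (- u) =
   expR (- u) * (expR u - expR (- u) - 2 * u).
  rewrite expRN; field; exact: lt0r_neq0 (expR_gt0 _).
by rewrite mulr_ge0 // expR_ge0.
Qed.
End elementary.

(** * The left branch in a logarithmic coordinate *)

Section exponent.
Context {R : realType}.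
Variable b : R.
Hypotheses (b_gt0 : 0 < b) (b_le1 : b <= 1).
Implicit Types r : R.

(** In the coordinate [r = - ln (1 - 2 * z)] of a point [z] left of 1/2, the
    doubly exponential formula for [f_b] becomes
    [1 - f_b z = expR (- loggap r)], with [loggap] smooth, convex and vanishing
    at 0. *)
Definition loggap (r : R) := 2 `^ b * ((r + ln 2) * expR (b * r) - ln 2).
Definition dloggap (r : R) := 2 `^ b * (expR (b * r) * (1 + b * (r + ln 2))).

Lemma powR2b_ge1 : 1 <= 2 `^ b :> R.
Proof. by rewrite -{1}(powRr0 2); apply: ler_powR; [lra|exact: ltW]. Qed.

Lemma powR2b_le2 : 2 `^ b <= 2 :> R.
Proof. by apply: ler1_powR => //; have := b_le1; lra. Qed.

Lemma loggap0 : loggap 0 = 0.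
Proof. by rewrite /loggap mulr0 expR0; ring. Qed.

Lemma is_derive_loggap r : is_derive r 1 loggap (dloggap r).
Proof. rewrite /loggap; apply: is_derive_eq; rewrite /dloggap /GRing.scale/=; ring. Qed.

Lemma dloggap_ge1 r : 0 <= r -> 1 <= dloggap r.
Proof.
have b0 := b_gt0; have b1 := b_le1.
move=> r0; rewrite /dloggap.
have h1 : 1 <= expR (b * r) by rewrite -expR0 ler_expR mulr_ge0// ltW.
have h2 : 1 <= 1 + b * (r + ln 2).
  by have := ln2_gt0 (R:=R) => l0; rewrite lerDl mulr_ge0//; lra.
have h3 := powR2b_ge1.
by rewrite !mulr_ege1.
Qed.

Lemma dloggap_gt0 r : 0 <= r -> 0 < dloggap r.
Proof. by move=> /dloggap_ge1; lra. Qed.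

(** The chord of the convex function [loggap] from 0 lies below its tangent. *)
Lemma loggap_le r : 0 <= r -> loggap r <= r * dloggap r.
Proof.
have b0 := b_gt0; have b1 := b_le1.
move=> r0; rewrite /loggap /dloggap [r * _]mulrCA.
rewrite ler_wpM2l ?powR_ge0//.
have l0 := ln2_gt0 (R:=R).
have h : expR (b * r) * (1 - b * r) <= 1.
  have := expR_ge1Dx (- (b * r)); rewrite expRN => h.
  have e0 := expR_gt0 (b * r).
  by rewrite -[leRHS](mulfV (lt0r_neq0 e0)); apply: ler_wpM2l => //; exact: ltW.
set e := expR (b * r) in h *.
have e_gt0 : 0 < e by exact: expR_gt0.
have : 0 <= ln 2 * (1 - e * (1 - b * r)) by apply: mulr_ge0; lra.
have : 0 <= b * r * (r * e) by rewrite !mulr_ge0// ltW.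
by nra.
Qed.

Lemma loggap_growth r r' : 0 <= r -> r <= r' -> r' - r <= loggap r' - loggap r.
Proof.
have b0 := b_gt0; have b1 := b_le1.
move=> r0 rr'.
suff : loggap r - r <= loggap r' - r' by lra.
apply: (@le_of_derive_ge0 _ (fun x => loggap x - x) (fun x => dloggap x - 1)) => // x /andP[rx _].
  have := is_derive_loggap x => ?; exact: is_deriveB.
by rewrite subr_ge0 dloggap_ge1// (le_trans r0).
Qed.

Lemma loggap_ge r : 0 <= r -> r <= loggap r.
Proof. by move=> r0; have := loggap_growth 0 r (lexx _) r0; rewrite loggap0 !subr0. Qed.

Lemma loggap_gt0 r : 0 < r -> 0 < loggap r.
Proof. by move=> r0; rewrite (lt_le_trans r0)// loggap_ge// ltW. Qed.

Lemma loggap_inj_lt r r' : 0 <= r -> r < r' -> loggap r < loggap r'.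
Proof. by move=> r0 rr'; have := loggap_growth r r' r0 (ltW rr'); lra. Qed.

(** The logarithmic derivative of [dloggap] is at most 2. *)
Lemma dloggap_le_expR r r' : 0 <= r -> r <= r' ->
  dloggap r' <= expR (2 * (r' - r)) * dloggap r.
Proof.
have b0 := b_gt0; have b1 := b_le1.
move=> r0 rr'; have l0 := ln2_gt0 (R:=R).
have [d dE] : exists d, r' = r + d by exists (r' - r); ring.
subst r'; have d0 : 0 <= d by lra.
rewrite /dloggap [expR (2 * _) * _]mulrCA ler_wpM2l ?powR_ge0//.
have -> : 2 * (r + d - r) = d + d by ring.
have p : 0 <= b * (r + ln 2) by apply: mulr_ge0; lra.
have -> : b * (r + d) = b * r + b * d by ring.
rewrite !expRD [leRHS]mulrCA -[leLHS]mulrA.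
apply: ler_wpM2l; first exact: expR_ge0.
rewrite -mulrA; have bd : b * d <= d by rewrite -[leRHS]mul1r ler_wpM2r.
apply: ler_pM.
- exact: expR_ge0.
- have := mulr_ge0 (ltW b0) d0; lra.
- by rewrite ler_expR.
- apply: (@le_trans _ _ ((1 + d) * (1 + b * (r + ln 2)))).
    have := mulr_ge0 d0 p; nra.
  by rewrite ler_wpM2r ?expR_ge1Dx//; lra.
Qed.

Lemma dloggap_nondecr r r' : 0 <= r -> r <= r' -> dloggap r <= dloggap r'.
Proof.
have b0 := b_gt0; have b1 := b_le1.
move=> r0 rr'; rewrite /dloggap ler_wpM2l ?powR_ge0//.
have l0 := ln2_gt0 (R:=R).
apply: ler_pM; rewrite ?expR_ge0//.
- have : 0 <= b * (r + ln 2) by rewrite mulr_ge0; lra.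
  lra.
- by rewrite ler_expR ler_wpM2l// ltW.
- by rewrite lerD2l ler_wpM2l ?(ltW b_gt0)// lerD2r.
Qed.

(** With [E = loggap r], the expression is [E' / 2 * coth (E / 2) - 1 / sinh r],
    and [E' / 2 * coth (E / 2) >= E' / E >= 1 / r >= 1 / sinh r]. *)
Lemma expansion_deriv_ge0 r : 0 < r ->
  0 <= expR (- loggap r) / (1 - expR (- loggap r)) * dloggap r + dloggap r / 2
       - expR (- r) / (1 - expR (- r)) - expR (- r) / (1 + expR (- r)).
Proof.
have b0 := b_gt0; have b1 := b_le1.
move=> r0.
have E0 := loggap_gt0 r r0; have E'0 := dloggap_gt0 r (ltW r0).
have ErE' := loggap_le r (ltW r0).
have ha := expRN_gap _ (ltW E0).
have hb := sinh_ge_id _ (ltW r0).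
have qE0 := expR_gt0 (- loggap r).
have q0 := expR_gt0 (- r).
have qE1 : expR (- loggap r) < 1 by rewrite expR_lt1; lra.
have q1 : expR (- r) < 1 by rewrite expR_lt1; lra.
set qE := expR (- loggap r) in ha qE0 qE1 *.
set q := expR (- r) in hb q0 q1 *.
have -> : qE / (1 - qE) * dloggap r + dloggap r / 2 =
  dloggap r * ((1 + qE) / (2 * (1 - qE))) by field; lra.
have -> : dloggap r * ((1 + qE) / (2 * (1 - qE))) - q / (1 - q) - q / (1 + q) =
  dloggap r * ((1 + qE) / (2 * (1 - qE))) - 2 * q / (1 - q ^+ 2).
  by field; nra.
have h1 : 2 * q / (1 - q ^+ 2) <= r^-1.
  rewrite ler_pdivrMr; last by nra.
  by rewrite ler_pdivlMl//; lra.
have h2 : (loggap r)^-1 <= (1 + qE) / (2 * (1 - qE)).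
  rewrite ler_pdivlMr; last by lra.
  by rewrite ler_pdivrMl//; lra.
have h3 : r^-1 <= dloggap r * (loggap r)^-1.
  by rewrite ler_pdivlMr// ler_pdivrMl.
have := ler_wpM2l (ltW E'0) h2; lra.
Qed.

End exponent.

(** * Expansion and distortion of the left branch *)

Section branch.
Context {R : realType}.
Implicit Types b r x z : R.

Definition left_point r : R := (1 - expR (- r)) / 2.
Definition logit x : R := ln x - ln (1 - x).

Lemma left_point_itv r : 0 <= r -> 0 <= left_point r < 2^-1.
Proof.
move=> r0; rewrite /left_point; have := expR_gt0 (- r).
have : expR (- r) <= 1 by rewrite expR_le1; lra.
lra.
Qed.

Lemma left_point_surj z : 0 <= z < 2^-1 -> exists2 r, 0 <= r & z = left_point r.
Proof.
move=> /andP[z0 z1]; have h : 0 < 1 - 2 * z by lra.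
exists (- ln (1 - 2 * z)); first by rewrite oppr_ge0 ln_le0//; lra.
by rewrite /left_point opprK lnK ?posrE//; by field.
Qed.

Lemma left_point_le r r' : (left_point r <= left_point r') = (r <= r').
Proof. by rewrite /left_point ler_pM2r ?invr_gt0// lerD2l lerN2 ler_expR lerN2. Qed.

Lemma left_point_lt r r' : (left_point r < left_point r') = (r < r').
Proof. by rewrite !ltNge left_point_le. Qed.

Lemma flat_map_sym b x : flat_map b (1 - x) = flat_map b x.
Proof.
rewrite /flat_map; have -> : 1 - x - 2^-1 = - (x - 2^-1) by field.
rewrite normrN; congr (if _ then _ else _).
by apply/eqP/eqP => h; lra.
Qed.

Lemma flat_map_half b : flat_map b 2^-1 = 1 :> R.
Proof. by rewrite /flat_map eqxx. Qed.

Lemma flat_map_left_point b r : 0 <= r ->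
  flat_map b (left_point r) = 1 - expR (- loggap b r).
Proof.
move=> r0; have /andP[z0 z1] := left_point_itv r r0.
rewrite /flat_map lt_eqF//=.
have -> : `|left_point r - 2^-1| = expR (- (r + ln 2)).
  rewrite distrC ger0_norm; last by lra.
  rewrite opprD expRD /left_point [expR (- ln 2)]expRN lnK ?posrE//; by field.
congr (1 - _).
have p2 (y : R) : 2 `^ y = expR (y * ln 2) by rewrite /powR pnatr_eq0.
rewrite [(expR _) `^ _]/powR gt_eqF ?expR_gt0// -expRM p2 -expRD expRK; congr expR.
have -> : - (r + ln 2) * - b = b * r + b * ln 2 by ring.
rewrite /loggap p2 expRD; ring.
Qed.

Opaque flat_map loggap dloggap.

Section fixed_parameter.
Variable b : R.
Hypotheses (b_gt0 : 0 < b) (b_le1 : b <= 1).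

Lemma flat_map_itv z : 0 <= z < 2^-1 -> 0 <= flat_map b z < 1.
Proof.
move=> /left_point_surj[r r0 ->]; rewrite flat_map_left_point//.
have := loggap_ge b b_gt0 b_le1 r r0; have := expR_gt0 (- loggap b r) => h1 h2.
have : expR (- loggap b r) <= 1 by rewrite expR_le1; lra.
lra.
Qed.

Lemma flat_map_ge_double z : 0 <= z < 2^-1 -> 2 * z <= flat_map b z.
Proof.
move=> /left_point_surj[r r0 ->]; rewrite flat_map_left_point// /left_point.
have : expR (- loggap b r) <= expR (- r) by rewrite ler_expR lerN2 loggap_ge.
lra.
Qed.

Lemma flat_map_lt z z' : 0 <= z -> z < z' -> z' < 2^-1 ->
  flat_map b z < flat_map b z'.
Proof.
move=> z0 zz' z'1.
have [|r r0 zE] := left_point_surj z; first by lra.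
have [|r' r'0 z'E] := left_point_surj z'; first by lra.
move: zz'; rewrite zE z'E left_point_lt => /(loggap_inj_lt b b_gt0 b_le1 _ _ r0).
by rewrite !flat_map_left_point// ltrD2l ltrN2 ltr_expR ltrN2.
Qed.

Lemma flat_map_le z z' : 0 <= z -> z <= z' -> z' < 2^-1 ->
  flat_map b z <= flat_map b z'.
Proof.
by move=> z0; rewrite le_eqVlt => /predU1P[->//|zz' z'1]; exact/ltW/flat_map_lt.
Qed.

Lemma ln_1B_flat_map r : 0 <= r ->
  ln (1 - flat_map b (left_point r)) = - loggap b r.
Proof. by move=> r0; rewrite flat_map_left_point// subKr expRK. Qed.

(** The left branch expands hyperbolic length, and the surplus is at least half
    of the increment of [- ln (1 - f_b)].  The surplus is what later pays both
    for distortion and for the shrinking of preimages.  In the coordinate [r]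
    this is the monotonicity of a function whose derivative is computed in
    [expansion_deriv_ge0]. *)
Lemma logit_expansion z z' : 0 < z -> z <= z' -> z' < 2^-1 ->
  logit z' - logit z +
     (ln (1 - flat_map b z) - ln (1 - flat_map b z')) / 2
  <= logit (flat_map b z') - logit (flat_map b z).
Proof.
move=> z0 zz' z'1.
have [|r r0 zE] := left_point_surj z; first by lra.
have [|r' r'0 z'E] := left_point_surj z'; first by lra.
have rr' : r <= r' by rewrite -left_point_le -zE -z'E.
have {r0}r_gt0 : 0 < r.
  rewrite lt_neqAle r0 andbT; apply/eqP => r00; move: z0.
  by rewrite zE -r00 /left_point oppr0 expR0; lra.
pose M x := ln (1 - expR (- loggap b x)) + loggap b x / 2
            - ln (1 - expR (- x)) + ln (1 + expR (- x)).
pose dM x := expR (- loggap b x) / (1 - expR (- loggap b x)) * dloggap b x + dloggap b x / 2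
       - expR (- x) / (1 - expR (- x)) - expR (- x) / (1 + expR (- x)).
have Mrr' : M r <= M r'.
  apply: (@le_of_derive_ge0 _ M dM) => // x /andP[rx _].
    have x0 : 0 < x by exact: lt_le_trans rx.
    have E0 := loggap_gt0 b b_gt0 b_le1 _ x0.
    have h1 : 0 < 1 - expR (- loggap b x) by rewrite subr_gt0 expR_lt1; lra.
    have h2 : 0 < 1 - expR (- x) by rewrite subr_gt0 expR_lt1; lra.
    have h3 : 0 < 1 + expR (- x) by have := expR_gt0 (- x); lra.
    have dE := is_derive_loggap b x.
    have d1 := is_derive1_ln h1.
    have d2 := is_derive1_ln h2.
    have d3 := is_derive1_ln h3.
    have c1 : is_derive x 1 (fun x => 1 - expR (- loggap b x)) (expR (- loggap b x) * dloggap b x).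
      by apply: is_derive_eq; rewrite /GRing.scale/=; ring.
    have c2 : is_derive x 1 (fun x => 1 - expR (- x)) (expR (- x)).
      by apply: is_derive_eq; rewrite /GRing.scale/=; ring.
    have c3 : is_derive x 1 (fun x => 1 + expR (- x)) (- expR (- x)).
      by apply: is_derive_eq; rewrite /GRing.scale/=; ring.
    have e1 := @is_derive1_comp R (@ln R) (fun x => 1 - expR (- loggap b x)) x _ _ d1 c1.
    have e2 := @is_derive1_comp R (@ln R) (fun x => 1 - expR (- x)) x _ _ d2 c2.
    have e3 := @is_derive1_comp R (@ln R) (fun x => 1 + expR (- x)) x _ _ d3 c3.
    rewrite /M; apply: is_derive_eq.
    rewrite /dM /GRing.scale/=; field; lra.
  by apply: (expansion_deriv_ge0 b b_gt0 b_le1); exact: lt_le_trans rx.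
have logitE x : 0 < x -> logit (flat_map b (left_point x)) - logit (left_point x)
    + ln (1 - flat_map b (left_point x)) / 2 = M x.
  move=> x0; rewrite /logit ln_1B_flat_map ?(ltW x0)// flat_map_left_point ?(ltW x0)//.
  have h2 : 0 < 1 - expR (- x) by rewrite subr_gt0 expR_lt1; lra.
  have h3 : 0 < 1 + expR (- x) by have := expR_gt0 (- x); lra.
  rewrite /left_point; have -> : 1 - (1 - expR (- x)) / 2 = (1 + expR (- x)) / 2 by field.
  rewrite !ln_div ?posrE// /M; lra.
have := logitE r' (lt_le_trans r_gt0 rr'); have := logitE r r_gt0; move: Mrr'.
rewrite -zE -z'E; move: (M r) (M r') (logit z) (logit z') (logit (flat_map b z))
  (logit (flat_map b z')) (ln (1 - flat_map b z)) (ln (1 - flat_map b z')).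
move=> *; lra.
Qed.

(** The derivative of [f_b] at [left_point r]. *)
Definition slope r := 2 * dloggap b r * expR (r - loggap b r).

(** The logarithm of [slope] is [ln 2 + ln (dloggap r) + r - loggap r].  Since
    [dloggap >= 1], the variations of [r] and of [ln dloggap] are at most once
    and twice that of [loggap], whence the factor 4 = 2 + 1 + 1. *)
Lemma slope_distortion r r' p q : 0 <= p -> p <= r <= q -> p <= r' <= q ->
  slope r <= expR (4 * (loggap b q - loggap b p)) * slope r'.
Proof.
move=> p0 /andP[pr rq] /andP[pr' r'q].
have r0 := le_trans p0 pr; have r'0 := le_trans p0 pr'.
have G := loggap_growth b b_gt0 b_le1.
rewrite /slope -(mulrA 2 (dloggap b r)) -(mulrA 2 (dloggap b r')) [leRHS]mulrCA ler_pM2l ?ltr0n//.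
have e0 := dloggap_gt0 b b_gt0 b_le1 _ r'0.
have [rr'|r'r] := leP r r'.
  rewrite [leRHS]mulrCA -expRD; apply: ler_pM; rewrite ?expR_ge0//.
  - by rewrite ltW// (dloggap_gt0 b b_gt0 b_le1).
  - exact: dloggap_nondecr.
  - rewrite ler_expR.
    have := G _ _ p0 pr; have := G _ _ r0 rr'; have := G _ _ r'0 r'q; lra.
have hE := dloggap_le_expR b b_gt0 b_le1 _ _ r'0 (ltW r'r).
apply: (@le_trans _ _ (expR (2 * (r - r')) * dloggap b r' * expR (r - loggap b r))).
  by rewrite ler_wpM2r ?expR_ge0.
rewrite [leRHS]mulrCA -[leLHS]mulrA [leLHS]mulrCA ler_wpM2l ?(ltW e0)// -!expRD ler_expR.
have := G _ _ p0 pr'; have := G _ _ r'0 (ltW r'r); have := G _ _ r0 rq; lra.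
Qed.

Lemma flat_map_slope r r' : 0 <= r -> r < r' -> exists2 t, r <= t <= r' &
  flat_map b (left_point r') - flat_map b (left_point r) =
  slope t * (left_point r' - left_point r).
Proof.
move=> r0 rr'.
have r'0 : 0 <= r' by rewrite (le_trans r0)// ltW.
pose g x := 1 - expR (- loggap b x).
have dg x : is_derive x 1 g (expR (- loggap b x) * dloggap b x).
  have dE := is_derive_loggap b x.
  by apply: is_derive_eq; rewrite /GRing.scale/=; ring.
have dz x : is_derive x 1 left_point (expR (- x) / 2).
  by rewrite /left_point; apply: is_derive_eq; rewrite /GRing.scale/=; ring.
have [|||t] := @cauchy_MVT R g (fun x => expR (- loggap b x) * dloggap b x)
    left_point (fun x => expR (- x) / 2) _ _ rr' _ _ (fun x _ => dg x) (fun x _ => dz x).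
- by apply: is_derive_within_continuous => x _; exact: dg.
- by apply: is_derive_within_continuous => x _; exact: dz.
- by move=> x _; rewrite mulf_neq0 ?invr_neq0 ?pnatr_eq0//; exact/lt0r_neq0/expR_gt0.
rewrite in_itv/= => /andP[/ltW rt /ltW tr'] h.
exists t; first by rewrite rt.
rewrite !flat_map_left_point//.
have nz : left_point r' - left_point r != 0 by rewrite subr_eq0 gt_eqF// left_point_lt.
rewrite -[LHS](divfK nz); congr (_ * _); rewrite -[LHS]h.
rewrite /slope expRD [expR (- t)]expRN.
move: (expR (- loggap b t)) (dloggap b t) (expR t) (lt0r_neq0 (expR_gt0 t)) => x y e e0.
by field.
Qed.

(** Both difference quotients are values of [slope] by Cauchy's mean value
    theorem, applied in the coordinate [r]; their ratio is controlled by the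
    increment of [- ln (1 - f_b)], the same quantity as in
    [logit_expansion]. *)
Lemma branch_distortion c u v d : 0 <= c -> c <= u -> u < v -> v <= d -> d < 2^-1 ->
  (flat_map b v - flat_map b u) * (d - c) <=
  expR (4 * (ln (1 - flat_map b c) - ln (1 - flat_map b d))) *
  (v - u) * (flat_map b d - flat_map b c).
Proof.
move=> c0 cu uv vd d1.
have [|rc rc0 cE] := left_point_surj c; first by lra.
have [|ru ru0 uE] := left_point_surj u; first by lra.
have [|rv rv0 vE] := left_point_surj v; first by lra.
have [|rd rd0 dE] := left_point_surj d; first by lra.
move: cu uv vd; rewrite {}cE {}uE {}vE {}dE !left_point_le left_point_lt => cu uv vd.
have [t /andP[t1 t2] fuv] := flat_map_slope _ _ ru0 uv.
have cd : rc < rd by rewrite (le_lt_trans cu)// (lt_le_trans uv).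
have [t' t'cd fcd] := flat_map_slope _ _ rc0 cd.
rewrite [X in X * _ <= _]fuv [X in _ <= _ * X]fcd.
have -> : ln (1 - flat_map b (left_point rc)) - ln (1 - flat_map b (left_point rd)) =
    loggap b rd - loggap b rc.
  transitivity (- loggap b rc - - loggap b rd); last by ring.
  by congr (_ - _); exact: ln_1B_flat_map.
have h : slope t <= expR (4 * (loggap b rd - loggap b rc)) * slope t'.
  by apply: slope_distortion => //; rewrite (le_trans cu t1) (le_trans t2 vd).
have p1 : 0 <= left_point rv - left_point ru by rewrite subr_ge0 left_point_le ltW.
have p2 : 0 <= left_point rd - left_point rc by rewrite subr_ge0 left_point_le ltW.
have {h} := ler_wpM2r (mulr_ge0 p1 p2) h.
move: (slope t) (slope t') (left_point rv - left_point ru) (left_point rd - left_point rc)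
  (expR _) => s s' x y e.
have -> : s * (x * y) = s * x * y by ring.
by have -> : e * s' * (x * y) = e * x * (s' * y) by ring.
Qed.

End fixed_parameter.
End branch.

(** * The inverse of the left branch *)

Section inverse_branch.
Context {R : realType}.
Variable b : R.
Hypotheses (b_gt0 : 0 < b) (b_le1 : b <= 1).
Implicit Types x z c d u v eta a theta : R.

(** There is no closed formula for the inverse of the left branch, so the
    preimage is picked by choice; the value is the default 0 when there is
    none. *)
Definition left_pre (x : R) : R := xget 0 [set z | 0 <= z < 2^-1 /\ flat_map b z = x].

Lemma flat_map_surj x : 0 <= x < 1 -> exists2 z, 0 <= z < 2^-1 & flat_map b z = x.
Proof.
move=> /andP[x0 x1].
have y0 : 0 <= - ln (1 - x) by rewrite oppr_ge0 ln_le0//; lra.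
have [||r] := @IVT R (loggap b) 0 (- ln (1 - x)) (- ln (1 - x)) y0.
- by apply: is_derive_within_continuous => r _; exact: is_derive_loggap.
- rewrite loggap0 min_l ?(le_trans y0)// ?loggap_ge// ?y0//.
  by rewrite le_max loggap_ge ?orbT.
rewrite in_itv/= => /andP[r0 _] rE.
exists (left_point r); first exact: left_point_itv.
by rewrite flat_map_left_point// rE opprK lnK ?subKr// posrE; lra.
Qed.

Lemma left_preP x : 0 <= x < 1 -> 0 <= left_pre x < 2^-1 /\ flat_map b (left_pre x) = x.
Proof.
move=> /flat_map_surj[z zI zE].
by apply: (@xgetPex _ 0 [set z | 0 <= z < 2^-1 /\ flat_map b z = x]); exists z.
Qed.

Lemma left_pre_itv x : 0 <= x < 1 -> 0 <= left_pre x < 2^-1.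
Proof. by move=> /left_preP[]. Qed.

Lemma flat_mapK x : 0 <= x < 1 -> flat_map b (left_pre x) = x.
Proof. by move=> /left_preP[]. Qed.

Lemma left_pre_lt x x' : 0 <= x -> x < x' -> x' < 1 -> left_pre x < left_pre x'.
Proof.
move=> x0 xx' x'1.
have [|/andP[p0 p1] pE] := left_preP x; first by lra.
have [|/andP[p'0 p'1] p'E] := left_preP x'; first by lra.
rewrite ltNge; apply/negP => /(flat_map_le b b_gt0 b_le1 _ _ p'0)/(_ p1).
by rewrite pE p'E leNgt xx'.
Qed.

Lemma left_pre_le x x' : 0 <= x -> x <= x' -> x' < 1 -> left_pre x <= left_pre x'.
Proof.
by move=> x0; rewrite le_eqVlt => /predU1P[->//|xx' x'1]; exact/ltW/left_pre_lt.
Qed.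

Lemma left_pre_le_half x : 0 <= x < 1 -> 2 * left_pre x <= x.
Proof.
move=> xI; have [pI pE] := left_preP x xI.
by have := flat_map_ge_double b b_gt0 b_le1 _ pI; rewrite pE.
Qed.

Lemma left_pre0 : left_pre 0 = 0.
Proof.
have /andP[] : 0 <= left_pre 0 < 2^-1 by apply: left_pre_itv; lra.
have : 2 * left_pre 0 <= 0 by apply: left_pre_le_half; lra.
lra.
Qed.

Lemma left_pre_gt0 x : 0 < x < 1 -> 0 < left_pre x < 2^-1.
Proof.
move=> /andP[x0 x1]; have := left_pre_lt 0 x (lexx _) x0 x1; rewrite left_pre0 => ->.
by have [|/andP[]//] := left_preP x; lra.
Qed.

Lemma left_pre_flat_map_le x z : 0 <= x < 1 -> 0 <= z < 2^-1 ->
  (x <= flat_map b z) = (left_pre x <= z).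
Proof.
move=> xI zI; have [/andP[p0 p1] pE] := left_preP x xI.
move/andP: zI => [z0 z1]; apply/idP/idP => h.
  rewrite leNgt; apply/negP => /(flat_map_lt b b_gt0 b_le1 _ _ z0)/(_ p1).
  by rewrite pE ltNge h.
by rewrite -{1}pE (flat_map_le b).
Qed.

Lemma flat_map_left_pre_le x z : 0 <= x < 1 -> 0 <= z < 2^-1 ->
  (flat_map b z <= x) = (z <= left_pre x).
Proof.
move=> xI zI; have [/andP[p0 p1] pE] := left_preP x xI.
move/andP: zI => [z0 z1]; apply/idP/idP => h.
  rewrite leNgt; apply/negP => /(flat_map_lt b b_gt0 b_le1 _ _ p0)/(_ z1).
  by rewrite pE ltNge h.
by rewrite -[leRHS]pE (flat_map_le b).
Qed.

Lemma logit_sym x : logit (1 - x) = - logit x.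
Proof. by rewrite /logit subKr opprB. Qed.

Lemma left_pre_contraction x x' : 0 < x -> x <= x' -> x' < 1 ->
  logit (left_pre x') - logit (left_pre x) + (ln (1 - x) - ln (1 - x')) / 2
  <= logit x' - logit x.
Proof.
move=> x0 xx' x'1.
have /andP[p0 p1] : 0 < left_pre x < 2^-1 by apply: left_pre_gt0; lra.
have /andP[p'0 p'1] : 0 < left_pre x' < 2^-1 by apply: left_pre_gt0; lra.
have pp' : left_pre x <= left_pre x' by apply: left_pre_le => //; exact: ltW.
have := logit_expansion b b_gt0 b_le1 _ _ p0 pp' p'1.
by rewrite !flat_mapK//; lra.
Qed.

(** The quantity [(v - u) / (d - c) * expR (- 8 * (logit d - logit c))] does not
    decrease when both intervals are replaced by their left preimages.  Indeed
    [branch_distortion] loses at most the exponential of four times the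
    increment of [- ln (1 - x)], which [left_pre_contraction] bounds by eight
    times the loss of hyperbolic length.  Being monotone, the quantity can be
    followed through any number of preimages. *)
Lemma left_pre_distortion c u v d : 0 < c -> c <= u -> u < v -> v <= d -> d < 1 ->
  (v - u) * ((left_pre d - left_pre c) * expR (8 * (logit (left_pre d) - logit (left_pre c)))) <=
  expR (8 * (logit d - logit c)) * (d - c) * (left_pre v - left_pre u).
Proof.
move=> c0 cu uv vd d1.
have /andP[c'0 c'1] : 0 < left_pre c < 2^-1 by apply: left_pre_gt0; lra.
have /andP[d'0 d'1] : 0 < left_pre d < 2^-1 by apply: left_pre_gt0; lra.
have cu' : left_pre c <= left_pre u by apply: left_pre_le; lra.
have uv' : left_pre u < left_pre v by apply: left_pre_lt; lra.
have vd' : left_pre v <= left_pre d by apply: left_pre_le; lra.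
have := branch_distortion b b_gt0 b_le1 _ _ _ _ (ltW c'0) cu' uv' vd' d'1.
rewrite !flat_mapK; [|lra..] => h.
have cd : c <= d by lra.
have D := left_pre_contraction c d c0 cd d1.
have e0 := expR_gt0 (8 * (logit (left_pre d) - logit (left_pre c))).
have {h} := ler_wpM2r (ltW e0) h.
have : expR (4 * (ln (1 - c) - ln (1 - d))) * expR (8 * (logit (left_pre d) - logit (left_pre c)))
   <= expR (8 * (logit d - logit c)).
  by rewrite -expRD ler_expR; lra.
have p1 : 0 <= (d - c) * (left_pre v - left_pre u) by apply: mulr_ge0; lra.
by move=> /(ler_wpM2r p1); lra.
Qed.

(** * Shrinking of iterated preimages *)

(** The intervals that are short for a reason inherited by all their
    preimages: being hyperbolically short, close to 0, or close to 1. *)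
Definition tame (eta a c d : R) :=
  [\/ logit d - logit c <= eta, d <= a | 1 - a <= c].

(** The two preimages of an interval close to 0 are close to 0 and to 1, and
    those of an interval close to 1 lie near 1/2, where they are hyperbolically
    short; preimages of hyperbolically short intervals are even shorter. *)
Lemma tame_left_pre eta a c d : 0 < a < 1 ->
  (forall x, 1 - a <= x < 1 -> - eta <= logit (left_pre x)) ->
  0 < c -> c <= d -> d < 1 -> tame eta a c d ->
  tame eta a (left_pre c) (left_pre d) /\ tame eta a (1 - left_pre d) (1 - left_pre c).
Proof.
move=> /andP[a0 a1] Ha c0 cd d1.
have D := left_pre_contraction c d c0 cd d1.
have ln_mono : ln (1 - d) <= ln (1 - c) by rewrite ler_ln ?posrE; lra.
have /andP[d'0 d'1] : 0 < left_pre d < 2^-1 by apply: left_pre_gt0; lra.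
have /andP[c'0 c'1] : 0 < left_pre c < 2^-1 by apply: left_pre_gt0; lra.
have cd' : left_pre c <= left_pre d by apply: left_pre_le; lra.
have d'd : 2 * left_pre d <= d by apply: left_pre_le_half; lra.
case=> [h|h|h].
- by split; apply: Or31; rewrite ?logit_sym; lra.
- split; first by apply: Or32; lra.
  by apply: Or33; lra.
- have h1 : - eta <= logit (left_pre c) by apply: Ha; lra.
  have h2 : logit (left_pre d) <= 0.
    have : ln (left_pre d) <= ln (1 - left_pre d) by rewrite ler_ln ?posrE; lra.
    by rewrite /logit; lra.
  by split; apply: Or31; rewrite ?logit_sym; lra.
Qed.

Lemma subr_le_logit c d : 0 < c -> c <= d -> d < 1 -> d - c <= logit d - logit c.
Proof.
move=> c0 cd d1.
have h1 : ln (1 - d) <= ln (1 - c) by rewrite ler_ln ?posrE; lra.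
have d0 : 0 < d by lra.
have h2 : ln c - ln d <= c / d - 1.
  rewrite -ln_div ?posrE// -[X in ln X](subrK 1) addrC; apply: le_ln1Dx.
  have := divr_gt0 c0 d0; lra.
have h3 : d - c <= 1 - c / d.
  have -> : 1 - c / d = (d - c) / d by field; lra.
  by rewrite ler_pdivlMr//; nra.
by rewrite /logit; lra.
Qed.

Lemma logit_le_subr c d : 0 < c -> c <= d -> d < 1 ->
  logit d - logit c <= (d - c) / c + (d - c) / (1 - d).
Proof.
move=> c0 cd d1.
have lnB (x y : R) : 0 < x -> 0 < y -> ln x - ln y <= (x - y) / y.
  move=> x0 y0; rewrite -ln_div ?posrE//.
  have -> : x / y = 1 + (x - y) / y by field; lra.
  apply: le_ln1Dx; have := divr_gt0 x0 y0; have -> : (x - y) / y = x / y - 1 by field; lra.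
  lra.
have := lnB d c; have := lnB (1 - c) (1 - d).
have -> : 1 - c - (1 - d) = d - c by ring.
by rewrite /logit; lra.
Qed.

Lemma short_tame eta a c d : 0 < eta -> 0 < a < 1 -> 0 < c -> c <= d -> d < 1 ->
  8 * (d - c) <= a * eta -> 2 * (d - c) <= a -> tame eta a c d.
Proof.
move=> eta0 /andP[a0 a1] c0 cd d1 h1 h2.
have [hd|hd] := leP d a; first exact: Or32.
have [hc|hc] := leP (1 - a) c; first exact: Or33.
apply: Or31; apply: (le_trans (logit_le_subr _ _ c0 cd d1)).
have : (d - c) / c <= eta / 2 by rewrite ler_pdivrMr//; nra.
have : (d - c) / (1 - d) <= eta / 2 by rewrite ler_pdivrMr; nra.
lra.
Qed.

Lemma tame_short eta a c d : 0 < c -> c <= d -> d < 1 -> a <= eta ->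
  tame eta a c d -> d - c <= eta.
Proof.
move=> c0 cd d1 ae; have := subr_le_logit _ _ c0 cd d1.
by move=> h0 [h|h|h]; lra.
Qed.

(** A budget for [n] further preimages: each one that is not yet tame uses up
    [theta] of hyperbolic length. *)
Definition contracting eta a theta (n : nat) (c d : R) :=
  tame eta a c d \/ logit d - logit c <= n%:R * theta.

(** If taking a preimage gains less than [theta] of hyperbolic length, then
    [- ln (1 - x)] varies by less than [2 * theta] on [[c, d]], so [d - c] is
    less than [2 * theta] and the interval is tame. *)
Lemma contracting_left_pre eta a theta n c d : 0 < eta -> 0 < a < 1 ->
  (forall x, 1 - a <= x < 1 -> - eta <= logit (left_pre x)) ->
  16 * theta <= a * eta -> 4 * theta <= a ->
  0 < c -> c <= d -> d < 1 -> contracting eta a theta n.+1 c d ->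
  contracting eta a theta n (left_pre c) (left_pre d) /\
  contracting eta a theta n (1 - left_pre d) (1 - left_pre c).
Proof.
move=> eta0 aI Ha t1 t2 c0 cd d1 h.
suff [|h1] : tame eta a c d \/ logit (left_pre d) - logit (left_pre c) <= n%:R * theta.
- by move=> /(tame_left_pre _ _ _ _ aI Ha c0 cd d1)[]; split; left.
- by split; right => //; rewrite !logit_sym; lra.
case: h => [|h]; first by left.
have D := left_pre_contraction c d c0 cd d1.
have [g|g] := leP (2 * theta) (ln (1 - c) - ln (1 - d)).
  by right; move: h; rewrite -natr1; lra.
left; apply: short_tame => //.
all: have : d - c <= ln (1 - c) - ln (1 - d); last by move: aI => /andP[]; lra.
all: have e : ln ((1 - d) / (1 - c)) <= (1 - d) / (1 - c) - 1;
  [rewrite -[X in ln X](subrK 1) addrC; apply: le_ln1Dx;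
   have : 0 < (1 - d) / (1 - c) by [apply: divr_gt0; lra]; lra|].
all: move: e; rewrite ln_div ?posrE; [|lra..].
all: have -> : (1 - d) / (1 - c) - 1 = - ((d - c) / (1 - c)) by [field; lra].
all: have : d - c <= (d - c) / (1 - c) by [rewrite ler_pdivlMr; nra].
all: lra.
Qed.

Lemma logit_left_pre_near1 eta : 0 < eta -> exists2 a, 0 < a < 1 & a <= eta /\
  forall x, 1 - a <= x < 1 -> - eta <= logit (left_pre x).
Proof.
move=> eta0; pose z := (1 + expR eta)^-1.
have e1 : 1 < expR eta by rewrite expR_gt1.
have z0 : 0 < z by rewrite /z invr_gt0; lra.
have z1 : z < 2^-1 by rewrite /z ltf_pV2 ?posrE; lra.
have zl : logit z = - eta.
  rewrite /logit; have -> : 1 - z = expR eta * z by rewrite /z; field; lra.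
  by rewrite lnM ?posrE ?expR_gt0// expRK; lra.
have /andP[f0 f1] : 0 <= flat_map b z < 1 by apply: flat_map_itv => //; lra.
pose a := Num.min (Num.min eta 2^-1) (1 - flat_map b z).
have ale : a <= eta by rewrite /a !ge_min lexx.
have ahalf : a <= 2^-1 by rewrite /a !ge_min lexx orbT.
have af : a <= 1 - flat_map b z by rewrite /a !ge_min lexx orbT.
have a0 : 0 < a by rewrite /a !lt_min eta0 invr_gt0 ltr0n /= subr_gt0.
exists a; first by lra.
split=> // x /andP[xa x1].
have fx : flat_map b z <= x by lra.
have zx : z <= left_pre x by rewrite -flat_map_left_pre_le//; lra.
have /andP[_ p1] : 0 < left_pre x < 2^-1 by apply: left_pre_gt0; lra.
rewrite -zl /logit.
have : ln z <= ln (left_pre x) by rewrite ler_ln ?posrE; lra.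
have : ln (1 - left_pre x) <= ln (1 - z) by rewrite ler_ln ?posrE; lra.
lra.
Qed.

(** * Preimages of intervals *)

Lemma flat_map_01 x : 0 <= x <= 1 -> 0 <= flat_map b x <= 1.
Proof.
have left y : 0 <= y < 2^-1 -> 0 <= flat_map b y <= 1.
  by move=> /(flat_map_itv b b_gt0 b_le1); lra.
move=> xI; have [h|h] := ltP x 2^-1; first by apply: left; lra.
have [->|nh] := eqVneq x 2^-1; first by rewrite flat_map_half; lra.
have {}h : 2^-1 < x by rewrite lt_neqAle eq_sym nh.
by rewrite -flat_map_sym; apply: left; lra.
Qed.

Lemma flat_map_preimage c d : 0 <= c -> c <= d -> d < 1 ->
  `[0, 1] `&` flat_map b @^-1` `[c, d] =
  `[left_pre c, left_pre d] `|` `[1 - left_pre d, 1 - left_pre c].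
Proof.
move=> c0 cd d1.
have cI : 0 <= c < 1 by lra.
have dI : 0 <= d < 1 by lra.
have /andP[c'0 c'1] := left_pre_itv c cI.
have /andP[d'0 d'1] := left_pre_itv d dI.
have cd' : left_pre c <= left_pre d by exact: left_pre_le.
have left y : 0 <= y < 2^-1 -> (c <= flat_map b y <= d) = (left_pre c <= y <= left_pre d).
  by move=> yI; rewrite (left_pre_flat_map_le _ _ cI)// (flat_map_left_pre_le _ _ dI).
apply/seteqP; split => x /=; rewrite !in_itv/=.
- move=> [xI]; have [h|h] := ltP x 2^-1.
    by rewrite left; [left|lra].
  have [->|nh] := eqVneq x 2^-1; first by rewrite flat_map_half; lra.
  have {}h : 2^-1 < x by rewrite lt_neqAle eq_sym nh.
  by rewrite -flat_map_sym left; [right|]; lra.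
- case=> h; first by split; [lra|rewrite left; lra].
  by split; [lra|rewrite -flat_map_sym left; lra].
Qed.

Lemma flat_map_preimage1 c : 0 <= c < 1 ->
  `[0, 1] `&` flat_map b @^-1` `[c, 1] = `[left_pre c, 1 - left_pre c]%classic.
Proof.
move=> cI; have /andP[c'0 c'1] := left_pre_itv c cI.
have left y : 0 <= y < 2^-1 -> (c <= flat_map b y <= 1) = (left_pre c <= y).
  move=> yI; rewrite (left_pre_flat_map_le _ _ cI)//.
  have /andP[_ /ltW->] := flat_map_itv b b_gt0 b_le1 y yI.
  by rewrite andbT.
apply/seteqP; split => x /=; rewrite !in_itv/=.
- move=> [xI]; have [h|h] := ltP x 2^-1.
    by rewrite left; lra.
  have [->|nh] := eqVneq x 2^-1; first by lra.
  have {}h : 2^-1 < x by rewrite lt_neqAle eq_sym nh.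
  by rewrite -flat_map_sym left; lra.
- move=> h; split; first by lra.
  have [h'|h'] := ltP x 2^-1; first by rewrite left; lra.
  have [->|nh] := eqVneq x 2^-1; first by rewrite flat_map_half; lra.
  have {}h' : 2^-1 < x by rewrite lt_neqAle eq_sym nh.
  by rewrite -flat_map_sym left; lra.
Qed.

End inverse_branch.

(** * Bounds uniform in the parameter *)

Section quantitative.
Context {R : realType}.
Variable b : R.
Hypotheses (b_gt0 : 0 < b) (b_le1 : b <= 1).
Implicit Types x z r : R.

Lemma ln2_le1 : ln 2 <= 1 :> R.
Proof.
have := @le_ln1Dx R 1; have -> : 1 + 1 = 2 :> R by ring.
by apply; lra.
Qed.

Lemma ln2_ge_half : 2^-1 <= ln 2 :> R.
Proof.
have h : ln (1 + - 2^-1) <= - 2^-1 :> R by apply: le_ln1Dx; lra.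
have e : 1 + - 2^-1 = 2^-1 :> R by field.
by move: h; rewrite e lnV ?posrE// lerN2.
Qed.

Lemma flat_map_le_lin z : 0 <= z < 2^-1 -> flat_map b z <= 48 * z.
Proof.
move=> zI; have /andP[_ f1] := flat_map_itv b b_gt0 b_le1 z zI.
have [z4|z4] := leP 4^-1 z; first by lra.
have [r r0 zE] := left_point_surj z zI.
have eN : expR (- r) = 1 - 2 * z by rewrite zE /left_point; field.
have er : expR r * (1 - 2 * z) = 1 by rewrite -eN expRxMexpNx_1.
have r1 : 1 + r <= expR r by exact: expR_ge1Dx.
have e2 : expR r <= 2 by have := expR_gt0 r; nra.
have r4 : r <= 4 * z by nra.
have d12 : dloggap b r <= 12.
  have b0 := b_gt0; have b1 := b_le1.
  have l0 := ln2_gt0 (R:=R); have l1 := ln2_le1.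
  (* the factors 2 `^ b, expR (b * r) and 1 + b * (r + ln 2) of dloggap *)
  have -> : 12 = 2 * (2 * 3) :> R by ring.
  apply: ler_pM; rewrite ?powR_ge0//.
  - apply: mulr_ge0; first exact: expR_ge0.
    have : 0 <= b * (r + ln 2) by apply: mulr_ge0; lra.
    lra.
  - exact: powR2b_le2.
  - apply: ler_pM; rewrite ?expR_ge0//.
    + have : 0 <= b * (r + ln 2) by apply: mulr_ge0; lra.
      lra.
    + by apply: le_trans e2; rewrite ler_expR; nra.
    + have : b * (r + ln 2) <= 1 * (r + ln 2) by apply: ler_wpM2r; lra.
      lra.
have f2 : flat_map b z <= loggap b r.
  by rewrite zE flat_map_left_point//; have := expR_ge1Dx (- loggap b r); lra.
have := loggap_le b b_gt0 b_le1 r r0.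
have : r * dloggap b r <= 4 * z * 12 by apply: ler_pM => //; exact/ltW/dloggap_gt0.
lra.
Qed.

Lemma left_pre_ge_lin x : 0 <= x < 1 -> x <= 48 * left_pre b x.
Proof.
move=> xI; have [pI pE] := left_preP b b_gt0 b_le1 x xI.
by rewrite -{1}pE; exact: flat_map_le_lin.
Qed.

(** With [r] the coordinate of the preimage, its distance to 1/2 is
    [expR (- r) / 2], and [expR r = expR (b * r) * expR ((1 - b) * r)].  The
    first factor is bounded linearly in [loggap r = - ln (1 - x)], the second
    one by 2 as soon as [b] is close to 1 in terms of [x]. *)
Lemma left_pre_gap x : 0 <= x < 1 -> - ((1 - b) * ln (1 - x)) <= ln 2 ->
  (4 * (1 - 2 * ln (1 - x)))^-1 <= 2^-1 - left_pre b x.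
Proof.
move=> xI; have [pI pE] := left_preP b b_gt0 b_le1 x xI.
have [r r0 zE] := left_point_surj _ pI.
have lE : ln (1 - x) = - loggap b r by rewrite -pE zE ln_1B_flat_map.
rewrite lE mulrN opprK => hb.
have rd := loggap_ge b b_gt0 b_le1 r r0.
have e1 : expR (b * r) <= 1 + 2 * loggap b r.
  have l0 := ln2_ge_half; have c1 := powR2b_ge1 b b_gt0.
  have ep := expR_gt0 (b * r).
  have e1 : 1 <= expR (b * r) by rewrite -expR0 ler_expR mulr_ge0// ltW.
  have h : ln 2 * (expR (b * r) - 1) <= loggap b r.
    rewrite /loggap; set k := _ - ln 2.
    have hk : ln 2 * (expR (b * r) - 1) <= k.
      by rewrite /k; have := mulr_ge0 r0 (ltW ep); lra.
    have : 0 <= ln 2 * (expR (b * r) - 1) by apply: mulr_ge0; lra.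
    nra.
  have : 2^-1 * (expR (b * r) - 1) <= ln 2 * (expR (b * r) - 1).
    by apply: ler_wpM2r; lra.
  lra.
have e2 : expR ((1 - b) * r) <= 2.
  rewrite -[leRHS](@lnK R) ?posrE// ler_expR; apply: le_trans hb.
  by apply: ler_wpM2l; have := b_le1; lra.
have er : expR r <= 2 * (1 + 2 * loggap b r).
  have -> : expR r = expR ((1 - b) * r) * expR (b * r).
    by rewrite -expRD; congr expR; ring.
  by apply: ler_pM; rewrite ?expR_ge0.
rewrite zE /left_point; have -> : 2^-1 - (1 - expR (- r)) / 2 = (2 * expR r)^-1.
  by rewrite expRN; field; exact/lt0r_neq0/expR_gt0.
by rewrite lef_pV2 ?posrE ?mulr_gt0 ?expR_gt0//; lra.
Qed.

End quantitative.

(** * Transport of mass ratios along preimages *)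

Lemma ratio_transfer {R : realDomainType} (w p q r E E' A X : R) :
  0 < w -> 0 <= p -> 0 <= X -> w * A <= E * q * X -> p * (q * E) <= E' * r * w ->
  p * A <= E' * r * X.
Proof.
move=> w0 p0 X0 h1 h2; rewrite -(ler_pM2l w0).
have := ler_wpM2l p0 h1; have := ler_wpM2r X0 h2; lra.
Qed.
Arguments ratio_transfer {R w p q r E E' A X}.

Section pullback.
Context {R : realType}.
Variable b : R.
Hypotheses (b_gt0 : 0 < b) (b_le1 : b <= 1).
Implicit Types (n : nat) (c d u v : R).

Definition pullback n c d : set R :=
  `[0, 1] `&` iter n (flat_map b) @^-1` `[c, d].

Lemma iter_flat_map_01 n x : 0 <= x <= 1 -> 0 <= iter n (flat_map b) x <= 1.
Proof. by move=> xI; elim: n => //= n IH; apply: flat_map_01. Qed.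

Lemma pullback0 c d : 0 <= c -> d <= 1 -> pullback 0 c d = `[c, d]%classic.
Proof.
move=> c0 d1; apply/seteqP; split=> x; rewrite /pullback/= !in_itv/=; first by case.
by move=> h; split=> //; lra.
Qed.

Lemma pullbackS n c d : 0 <= c -> c <= d -> d < 1 ->
  pullback n.+1 c d =
  pullback n (left_pre b c) (left_pre b d) `|`
  pullback n (1 - left_pre b d) (1 - left_pre b c).
Proof.
move=> c0 cd d1; have := flat_map_preimage b b_gt0 b_le1 _ _ c0 cd d1.
move=> /seteqP[h1 h2]; rewrite /pullback; apply/seteqP; split=> x.
- move=> [x01 /= fx]; move: (x01); rewrite /= in_itv/= => /(iter_flat_map_01 n) fn.
  by have [|h|h] := h1 (iter n (flat_map b) x); [split=> //=; rewrite in_itv/= | left | right].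
- case=> -[x01 fx]; split=> //.
    by have [_] := h2 (iter n (flat_map b) x) (or_introl fx).
  by have [_] := h2 (iter n (flat_map b) x) (or_intror fx).
Qed.

Lemma pullback_disjoint n c d c' d' : d < c' ->
  [disjoint pullback n c d & pullback n c' d'].
Proof.
move=> dc'; apply/disj_setPS => x [[_ /= h1] [_ /= h2]].
by move: h1 h2; rewrite !in_itv/=; lra.
Qed.

Lemma pullback_branches_disjoint n c d : 0 < c -> c <= d -> d < 1 ->
  [disjoint pullback n (left_pre b c) (left_pre b d)
    & pullback n (1 - left_pre b d) (1 - left_pre b c)].
Proof.
move=> c0 cd d1; apply: pullback_disjoint.
have /andP[_ ?] : 0 < left_pre b d < 2^-1 by apply: left_pre_gt0 => //; lra.
lra.
Qed.

Lemma left_pre_pair c d : 0 < c -> c <= d -> d < 1 ->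
  [/\ 0 < left_pre b c, left_pre b c <= left_pre b d & left_pre b d < 1] /\
  [/\ 0 < 1 - left_pre b d, 1 - left_pre b d <= 1 - left_pre b c & 1 - left_pre b c < 1].
Proof.
move=> c0 cd d1.
have /andP[? ?] : 0 < left_pre b c < 2^-1 by apply: left_pre_gt0 => //; lra.
have /andP[? ?] : 0 < left_pre b d < 2^-1 by apply: left_pre_gt0 => //; lra.
have ? : left_pre b c <= left_pre b d by apply: left_pre_le => //; lra.
by split; split; lra.
Qed.

Lemma measurable_pullback n c d : 0 < c -> c <= d -> d < 1 ->
  measurable (pullback n c d : set (measurableTypeR R)).
Proof.
elim: n c d => [|n IH] c d c0 cd d1; first by rewrite pullback0 ?ltW//; exact: measurable_itv.
rewrite pullbackS// ?ltW//; have [[? ? ?] [? ? ?]] := left_pre_pair _ _ c0 cd d1.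
by apply: measurableU; apply: IH.
Qed.

Variables (m e : set R -> R).
Hypothesis m_ge0 : forall A, 0 <= m A.
Hypothesis e_ge0 : forall A, 0 <= e A.
Hypothesis mU : forall A B : set (measurableTypeR R), measurable A -> measurable B ->
  A `|` B `<=` `[0, 1] -> [disjoint A & B] -> m (A `|` B) = m A + m B.
Hypothesis eU : forall A B : set (measurableTypeR R), measurable A -> measurable B ->
  A `|` B `<=` `[0, 1] -> [disjoint A & B] -> e (A `|` B) = e A + e B.

(** The set functions [m] and [e] stand for the invariant mass and for an
    error.  At small scales mass is assumed proportional to length up to [e].
    Going down the tree of preimages, [left_pre_distortion] keeps the ratio of
    the two lengths under control on each branch until the branches are short,
    and the branches are summed on the way back up; as they are disjoint, the
    errors add up to the error of their union. *)
Lemma harnack_pullback eta a theta : 0 < eta -> 0 < a < 1 -> a <= eta ->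
  (forall x, 1 - a <= x < 1 -> - eta <= logit (left_pre b x)) ->
  16 * theta <= a * eta -> 4 * theta <= a ->
  (forall c u v d, 0 < c -> c <= u -> u < v -> v <= d -> d < 1 -> d - c <= eta ->
     (v - u) * m `[c, d]%classic <= (d - c) * (m `[u, v]%classic + e `[c, d]%classic)) ->
  forall n c u v d, 0 < c -> c <= u -> u < v -> v <= d -> d < 1 ->
    contracting eta a theta n c d ->
  (v - u) * m (pullback n c d) <=
  expR (8 * (logit d - logit c)) * (d - c) * (m (pullback n u v) + e (pullback n c d)).
Proof.
move=> eta0 aI ae Ha t1 t2 base; elim=> [|n IH] c u v d c0 cu uv vd d1.
  move=> K; have cd : c <= d by lra.
  have T : tame eta a c d.
    by case: K => // h; apply: Or31; move: h; rewrite mul0r; lra.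
  have dc := tame_short _ _ _ _ c0 cd d1 ae T.
  rewrite !pullback0; [|lra..].
  apply: le_trans (base _ _ _ _ c0 cu uv vd d1 dc) _.
  apply: ler_wpM2r; first exact: addr_ge0.
  have := subr_le_logit _ _ c0 cd d1; have := expR_ge1Dx (8 * (logit d - logit c)).
  by move=> h1 h2; rewrite -[leLHS]mul1r; apply: ler_wpM2r; lra.
have cd : c <= d by lra.
have uv' := ltW uv.
have u0 : 0 < u by lra.
have v1 : v < 1 by lra.
move=> /(contracting_left_pre b b_gt0 b_le1 _ _ _ _ _ _ eta0 aI Ha t1 t2 c0 cd d1)[KL KR].
have [[cL cdL dL] [cR cdR dR]] := left_pre_pair _ _ c0 cd d1.
have [[uL uvL vL] [uR uvR vR]] := left_pre_pair _ _ u0 uv' v1.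
have cu' : left_pre b c <= left_pre b u by apply: left_pre_le => //; lra.
have uv1 : left_pre b u < left_pre b v by apply: left_pre_lt => //; lra.
have vd' : left_pre b v <= left_pre b d by apply: left_pre_le => //; lra.
have IHL := IH _ _ _ _ cL cu' uv1 vd' dL KL.
have IHR : (left_pre b v - left_pre b u) * m (pullback n (1 - left_pre b d) (1 - left_pre b c)) <=
   expR (8 * (logit (left_pre b d) - logit (left_pre b c))) * (left_pre b d - left_pre b c) *
   (m (pullback n (1 - left_pre b v) (1 - left_pre b u)) +
    e (pullback n (1 - left_pre b d) (1 - left_pre b c))).
  have := IH (1 - left_pre b d) (1 - left_pre b v) (1 - left_pre b u) (1 - left_pre b c) cR.
  rewrite !logit_sym.
  have -> : 1 - left_pre b u - (1 - left_pre b v) = left_pre b v - left_pre b u by ring.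
  have -> : 1 - left_pre b c - (1 - left_pre b d) = left_pre b d - left_pre b c by ring.
  have -> : - logit (left_pre b c) - - logit (left_pre b d) =
    logit (left_pre b d) - logit (left_pre b c) by ring.
  by apply => //; lra.
have K := left_pre_distortion b b_gt0 b_le1 _ _ _ _ c0 cu uv vd d1.
rewrite !pullbackS ?(ltW c0) ?(ltW u0)//.
have mP := measurable_pullback.
have add (g : set R -> R) x y : (forall A B : set (measurableTypeR R), measurable A -> measurable B ->
  A `|` B `<=` `[0, 1] -> [disjoint A & B] -> g (A `|` B) = g A + g B) ->
  0 < x -> x <= y -> y < 1 ->
  g (pullback n (left_pre b x) (left_pre b y) `|` pullback n (1 - left_pre b y) (1 - left_pre b x)) =
  g (pullback n (left_pre b x) (left_pre b y)) + g (pullback n (1 - left_pre b y) (1 - left_pre b x)).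
  move=> gU x0 xy y1; have [[? ? ?] [? ? ?]] := left_pre_pair _ _ x0 xy y1.
  apply: gU; [exact: mP|exact: mP| |exact: pullback_branches_disjoint].
  by move=> z [] [].
rewrite (add m c d)// (add m u v)// (add e c d)//.
rewrite mulrDr addrACA mulrDr; have w0 : 0 < left_pre b v - left_pre b u by rewrite subr_gt0.
have p0 : 0 <= v - u by rewrite subr_ge0.
by apply: lerD; apply: (ratio_transfer w0 p0 _ _ K); rewrite ?addr_ge0.
Qed.

End pullback.

(** * Integrable densities at small scales *)

Lemma continuous_uniform_on_compact {R : realType} (K : set R) (tau : R -> R) (w : R) :
  compact K -> continuous tau -> 0 < w ->
  exists2 d, 0 < d & forall x y, K x -> `|x - y| < d -> `|tau x - tau y| <= w.
Proof.
move=> /compact_near_coveringP cK ct w0.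
have w20 : 0 < w / 2 by lra.
have := cK R 0^'+ (fun d x => forall y, `|x - y| < d -> `|tau x - tau y| <= w) _.
case=> [x Kx|].
  have /cvgrPdist_lt/(_ _ w20) := ct x.
  rewrite near_simpl => /nbhs_ballP[r /= r0 Hr].
  exists (ball x (r / 2), [set d | d < r / 2]).
    split; first by apply: nbhsx_ballx; lra.
    by apply: nbhs_right_lt; lra.
  move=> [x' d] [xx' dr] y x'y; rewrite /= in xx' dr x'y.
  have h1 : `|tau x - tau x'| < w / 2.
    by apply: Hr; move: xx'; rewrite /ball/=; lra.
  have h2 : `|tau x - tau y| < w / 2.
    apply: Hr; move: xx'; rewrite /ball/= => xx'.
    have := ler_normD (x - x') (x' - y); rewrite subrKA; lra.
  have h := ler_normD (tau x' - tau x) (tau x - tau y); rewrite subrKA (distrC (tau x') (tau x)) in h.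
  by rewrite /=; lra.
move=> e /= e0 He; exists (e / 2); first by lra.
move=> x y Kx; apply: (He (e / 2)) => //=; last by lra.
by rewrite sub0r normrN gtr0_norm; lra.
Qed.

Lemma Rintegral_subset {d} {T : measurableType d} {R : realType}
    (nu : {measure set T -> \bar R}) (A B : set T) (g : T -> R) :
  measurable A -> measurable B -> A `<=` B -> nu.-integrable B (EFin \o g) ->
  (forall x, 0 <= g x) -> \int[nu]_(x in A) g x <= \int[nu]_(x in B) g x.
Proof.
move=> mA mB AB ig g0; have mBA : measurable (B `\` A) by exact: measurableD.
have BE : A `|` (B `\` A) = B by rewrite setUDr// setDv setD0; exact/setUidr.
rewrite -[in leRHS]BE Rintegral_setU ?BE//; last by apply/disj_setPS => x [? []].
by rewrite lerDl Rintegral_ge0.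
Qed.

Section absolutely_continuous.
Context {R : realType}.
Notation leb := (@lebesgue_measure R).
Variable mu : probability (measurableTypeR R) R.
Hypothesis mu_ac : mu `<< leb.

Lemma lebesgue_itvcc (c d : R) : c <= d -> fine (leb `[c, d]) = d - c.
Proof.
move=> cd; rewrite lebesgue_measure_itv/= lte_fin.
by move: cd; rewrite le_eqVlt => /predU1P[->|->]; rewrite ?ltxx ?subrr.
Qed.

Lemma ac_density : exists2 h : R -> R, leb.-integrable setT (EFin \o h) &
  forall A : set (measurableTypeR R), measurable A -> fine (mu A) = \int[leb]_(x in A) h x.
Proof.
pose h := Radon_Nikodym (charge_of_finite_measure mu) leb.
have ac : charge_of_finite_measure mu `<< leb := mu_ac.
have hfin x : h x \is a fin_num by exact: Radon_Nikodym_fin_num.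
have hE : EFin \o (fine \o h) = h by apply/funext => x /=; rewrite fineK.
exists (fine \o h); first by rewrite hE; exact: Radon_Nikodym_integrable.
move=> A mA; rewrite -[mu A]/(charge_of_finite_measure mu A) (Radon_Nikodym_integral ac mA) /Rintegral.
by congr fine; apply: eq_integral => x _; rewrite /= fineK.
Qed.

(** The error density is [g = 2 * (`|h - tau| + eps / 4)], where [h] is the
    density of the measure and [tau] a continuous function within [eps / 4] of
    [h] in mean.  On an interval short enough for [tau] to vary by at most
    [eps / 4], the deviation of [h] from the constant [tau c] is at most
    [g / 2], and it enters twice: through [[c, d]] and through [[u, v]]. *)
Lemma ac_oscillation (eps : R) : 0 < eps -> exists eta : R, exists2 g : R -> R,
  [/\ 0 < eta, forall x, 0 <= g x, leb.-integrable `[0, 1] (EFin \o g) &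
      \int[leb]_(x in `[0, 1]) g x <= eps] &
  forall c u v d : R, 0 <= c -> c <= u -> u < v -> v <= d -> d <= 1 -> d - c <= eta ->
    (v - u) * fine (mu `[c, d]%classic) <=
    (d - c) * (fine (mu `[u, v]%classic) + \int[leb]_(x in `[c, d]) g x).
Proof.
move=> eps0; have [h inth hE] := ac_density.
have m01 : measurable (`[0, 1]%classic : set (measurableTypeR R)) by exact: measurable_itv.
have leb01 : (leb `[0%R, 1%R] < +oo)%E.
  by rewrite lebesgue_measure_itv/= lte_fin ltr01 sube0 ltry.
have inth01 : leb.-integrable `[0, 1] (EFin \o h) by exact: integrableS inth.
have [t_ [ct it cvgt]] := approximation_continuous_integrable m01 leb01 inth01.
have e4 : 0 < eps / 4 by lra.
have [n Hn] : exists n, \int[leb]_(x in `[0, 1]) `|h x - t_ n x| <= eps / 4.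
  have /fine_cvgP[_ /cvgrPdist_lt/(_ _ e4)[N _ /(_ N (leqnn N))]] := cvgt.
  rewrite sub0r normrN => /ltW hN; exists N; apply: le_trans hN.
  exact: ler_norm.
have icst (A : set (measurableTypeR R)) r : measurable A -> A `<=` `[0%R : R, 1%R]%classic ->
    leb.-integrable A (EFin \o cst r).
  move=> mA A01; apply: (@integrableS _ _ _ leb `[0, 1]) => //.
  apply: (@continuous_compact_integrable R (cst r) `[0, 1]%classic); first exact: segment_compact.
  by move=> x; exact: cvg_cst.
have iabs : leb.-integrable `[0, 1] (EFin \o (fun x => `|h x - t_ n x|)).
  by apply: integrable_norm; exact: (@integrableB _ _ _ leb _ m01 (EFin \o h) (EFin \o t_ n)).
have intg0 (A : set (measurableTypeR R)) : measurable A -> A `<=` `[0%R : R, 1%R]%classic ->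
    leb.-integrable A (EFin \o (fun x => `|h x - t_ n x| + eps / 4)).
  move=> mA A01; apply: (@integrableS _ _ _ leb `[0, 1]) => //.
  apply: (@integrableD _ _ _ leb _ m01 (EFin \o (fun x => `|h x - t_ n x|)) (EFin \o cst (eps / 4))).
    exact: iabs.
  exact: icst.
have intg : leb.-integrable `[0, 1] (EFin \o (fun x => 2 * (`|h x - t_ n x| + eps / 4))).
  exact: (@integrableZl _ _ _ leb _ m01 2 (EFin \o (fun x => `|h x - t_ n x| + eps / 4))) (intg0 _ m01 _).
have [d d0 Hd] := continuous_uniform_on_compact _ _ _ (@segment_compact R 0 1) (ct n) e4.
exists (d / 2); exists (fun x => 2 * (`|h x - t_ n x| + eps / 4)).
  split=> //; first by lra.
  - by move=> x; apply: mulr_ge0 => //; apply: addr_ge0 => //; lra.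
  - rewrite RintegralZl//; last exact: intg0.
    rewrite (@RintegralD _ _ _ leb _ _ (cst (eps / 4)))//; last exact: icst.
    rewrite Rintegral_cst// lebesgue_itvcc//; lra.
move=> c u v d' c0 cu uv vd d1 short.
have mI (x y : R) : measurable (`[x, y]%classic : set (measurableTypeR R)) by exact: measurable_itv.
have cd : c <= d' by lra.
pose t := t_ n c.
have key x y : c <= x -> x <= y -> y <= d' ->
    `|fine (mu `[x, y]%classic) - (y - x) * t| <=
    \int[leb]_(z in `[c, d']) (`|h z - t_ n z| + eps / 4).
  move=> cx xy yd.
  have xy01 : `[x, y] `<=` `[0%R : R, 1%R]%classic.
    by move=> z /=; rewrite !in_itv/=; lra.
  have ih : leb.-integrable `[x, y] (EFin \o h) by exact: integrableS inth01.
  rewrite hE// -lebesgue_itvcc// mulrC -Rintegral_cst//.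
  rewrite -(@RintegralB _ _ _ leb _ _ (cst t))//; last exact: icst.
  have iht : leb.-integrable `[x, y] (EFin \o (fun z => h z - t)).
    exact: (@integrableB _ _ _ leb _ (mI x y) (EFin \o h) (EFin \o cst t) ih (icst _ _ (mI x y) xy01)).
  apply: le_trans (le_normr_Rintegral (mI x y) iht) _.
  apply: (@le_trans _ _ (\int[leb]_(z in `[x, y]) (`|h z - t_ n z| + eps / 4))).
    apply: le_Rintegral => //.
    - exact: integrable_norm.
    - exact: intg0.
    - move=> z /=; rewrite in_itv/= => zI.
      have hz : `|t_ n z - t_ n c| <= eps / 4.
        apply: Hd; first by rewrite /= in_itv/=; lra.
        by rewrite ger0_norm; lra.
      have := ler_normD (h z - t_ n z) (t_ n z - t_ n c).
      by rewrite subrKA /t; lra.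
  apply: Rintegral_subset => //.
  - by move=> z /=; rewrite !in_itv/=; lra.
  - by apply: intg0 => // z /=; rewrite !in_itv/=; lra.
  - by move=> z; apply: addr_ge0 => //; lra.
have := key u v cu (ltW uv) vd; have := key c d' (lexx _) cd (lexx _).
rewrite RintegralZl//; last by apply: intg0 => // x /=; rewrite !in_itv/=; lra.
set G := Rintegral _ _ _; rewrite !ler_norml => /andP[_ h1] /andP[h2 _].
have h3 := ler_wpM2l (_ : 0 <= v - u) h1.
have h4 := ler_wpM2l (_ : 0 <= d' - c) h2.
have G0 : 0 <= G by apply: Rintegral_ge0 => x _; apply: addr_ge0 => //; lra.
have h5 : (v - u) * G <= (d' - c) * G by apply: ler_wpM2r; lra.
have {}h3 := h3 ltac:(lra); have {}h4 := h4 ltac:(lra).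
lra.
Qed.
End absolutely_continuous.

(** * Harnack inequality for invariant measures *)

Section acip.
Context {R : realType}.
Variables (b : R) (mu : probability (measurableTypeR R) R).
Hypotheses (b_gt0 : 0 < b) (b_le1 : b <= 1).
Hypothesis acip_mu : is_acip (flat_map b) mu.
Implicit Types c d u v x : R.

Definition mass (A : set R) : R := fine (mu A).

Lemma mass_ge0 (A : set R) : 0 <= mass A.
Proof. exact: fine_ge0. Qed.

Lemma massU (A B : set (measurableTypeR R)) : measurable A -> measurable B ->
  [disjoint A & B] -> mass (A `|` B) = mass A + mass B.
Proof.
move=> mA mB /disj_setPS AB; rewrite /mass measureU ?fineD ?fin_num_measure//.
by apply/seteqP; split.
Qed.

Lemma mass_mono (A B : set (measurableTypeR R)) : measurable A -> measurable B ->
  A `<=` B -> mass A <= mass B.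
Proof.
by move=> mA mB AB; apply: fine_le; rewrite ?fin_num_measure// le_measure ?inE.
Qed.

Lemma mass01 : mass `[0, 1]%classic = 1.
Proof. by case: acip_mu => + _ _; rewrite /supported_on /mass => ->. Qed.

Lemma mass_preimage (c d : R) : 0 <= c -> d <= 1 ->
  mass (`[0, 1] `&` flat_map b @^-1` `[c, d]) = mass `[c, d]%classic.
Proof.
move=> c0 d1; case: acip_mu => _ inv _; rewrite /mass inv//.
by move=> x /=; rewrite !in_itv/=; lra.
Qed.

Lemma mass_branches c d : 0 <= c -> c <= d -> d < 1 ->
  mass `[c, d]%classic =
  mass `[left_pre b c, left_pre b d]%classic + mass `[1 - left_pre b d, 1 - left_pre b c]%classic.
Proof.
move=> c0 cd d1; rewrite -mass_preimage ?(ltW d1)// flat_map_preimage// massU//.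
apply/disj_setPS => x [] /=; rewrite !in_itv/=.
have /andP[_ ?] : 0 <= left_pre b d < 2^-1 by apply: left_pre_itv => //; lra.
lra.
Qed.

Lemma mass_pullback n c d : 0 < c -> c <= d -> d < 1 ->
  mass (pullback b n c d) = mass `[c, d]%classic.
Proof.
elim: n c d => [|n IH] c d c0 cd d1; first by rewrite pullback0 ?ltW.
rewrite pullbackS ?(ltW c0)//; have [[? ? ?] [? ? ?]] := left_pre_pair b b_gt0 b_le1 _ _ c0 cd d1.
rewrite massU; [|by apply: measurable_pullback..|exact: pullback_branches_disjoint].
by rewrite !IH// -mass_branches// ltW.
Qed.

(** By invariance the masses of [[c, d]] and [[u, v]] are those of their
    [n]-fold preimages, which [harnack_pullback] compares for [n] so large that
    the hyperbolic length of [[c, d]] is within the budget [n * theta]. *)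
Lemma mass_harnack c u v d : 0 < c -> c <= u -> u < v -> v <= d -> d < 1 ->
  (v - u) * mass `[c, d]%classic <=
  expR (8 * (logit d - logit c)) * (d - c) * mass `[u, v]%classic.
Proof.
move=> c0 cu uv vd d1; case: acip_mu => _ _ ac.
set Q := expR _ * (d - c).
have Q0 : 0 < Q by rewrite /Q mulr_gt0 ?expR_gt0//; lra.
apply/ler_addgt0Pr => eps eps0.
have epsQ : 0 < eps / Q by exact: divr_gt0.
have [eta [g [eta0 g0 ig gle] base]] := ac_oscillation mu ac _ epsQ.
have [a aI [ae Ha]] := logit_left_pre_near1 b b_gt0 b_le1 _ eta0.
have /andP[a0 a1] := aI.
have m01 : measurable (`[0, 1]%classic : set (measurableTypeR R)) by exact: measurable_itv.
pose e (A : set R) : R := \int[@lebesgue_measure R]_(x in A) g x.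
have eU (A B : set (measurableTypeR R)) : measurable A -> measurable B ->
  A `|` B `<=` `[0%R : R, 1%R]%classic -> [disjoint A & B] -> e (A `|` B) = e A + e B.
  move=> mA mB AB01 AB; rewrite /e Rintegral_setU//.
  by apply: integrableS ig => //; exact: measurableU.
pose theta := Num.min (a * eta / 16) (a / 4).
have th0 : 0 < theta by rewrite /theta lt_min !divr_gt0// mulr_gt0.
have t1 : 16 * theta <= a * eta.
  have : theta <= a * eta / 16 by rewrite /theta ge_min lexx.
  lra.
have t2 : 4 * theta <= a.
  have : theta <= a / 4 by rewrite /theta ge_min lexx orbT.
  lra.
pose n := Num.bound ((logit d - logit c) / theta).
have K : contracting eta a theta n c d.
  right; rewrite -ler_pdivrMr//; apply/ltW/archi_boundP/divr_ge0; last exact: ltW.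
  by have := subr_le_logit c d c0; lra.
have := @harnack_pullback R b b_gt0 b_le1 mass e mass_ge0 _ _ eU eta a theta
  eta0 aI ae Ha t1 t2 _ n c u v d c0 cu uv vd d1 K.
rewrite !mass_pullback; [|lra..] => H.
have {}H : (v - u) * mass `[c, d]%classic <= Q * (mass `[u, v]%classic + e (pullback b n c d)).
  apply: H.
  - by move=> A; exact: Rintegral_ge0.
  - by move=> A B mA mB _; exact: massU.
  - by move=> c' u' v' d' c'0 cu' uv' vd' d'1; apply: base => //; exact: ltW.
apply: (le_trans H); rewrite mulrDr lerD2l.
have : e (pullback b n c d) <= eps / Q.
  apply: le_trans gle; apply: Rintegral_subset => //; last by move=> x [].
  by apply: measurable_pullback => //; lra.
by rewrite ler_pdivlMr// mulrC.
Qed.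

(** * Escape of mass *)

Lemma mass_near1 x : 0 <= x < 1 ->
  mass `[x, 1]%classic = mass `[left_pre b x, 1 - left_pre b x]%classic.
Proof.
move=> xI; rewrite -mass_preimage ?flat_map_preimage1//; lra.
Qed.

Lemma mass_near0 x : 0 < x < 1 ->
  mass `[0, x]%classic = mass `[0, left_pre b x]%classic +
    mass `[left_pre b (1 - left_pre b x), 1 - left_pre b (1 - left_pre b x)]%classic.
Proof.
move=> /andP[x0 x1]; have /andP[p0 p1] : 0 < left_pre b x < 2^-1 by apply: left_pre_gt0 => //; lra.
rewrite (mass_branches 0 x) ?(ltW x0)// left_pre0// subr0 [X in _ + X]mass_near1//; lra.
Qed.

(** The interval [[gate_left k, 1 - gate_left k]] around 1/2 is the set of
    points that [f_b] sends to [[1 - a_(k+1), 1]], where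
    [a_k = iter k left_pre 2^-1]; from there they go to [[0, a_k]]. *)
Definition gate_left k := left_pre b (1 - iter k.+1 (left_pre b) 2^-1).

Lemma iter_left_pre_itv k : 0 < iter k (left_pre b) 2^-1 <= 2^-1.
Proof.
elim: k => [|k IH] /=; first by rewrite invr_gt0 ltr0n lexx.
have /andP[? ?] : 0 < left_pre b (iter k (left_pre b) 2^-1) < 2^-1 by apply: left_pre_gt0 => //; lra.
lra.
Qed.

(** Telescoping: by [mass_near0] the mass of the [k]-th gate is the mass of
    [[0, a_k]] minus that of [[0, a_(k+1)]]. *)
Lemma sum_mass_gates N : \sum_(k < N) mass `[gate_left k, 1 - gate_left k]%classic <= 1.
Proof.
have mI c d : measurable (`[c, d]%classic : set (measurableTypeR R)) by exact: measurable_itv.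
have -> : \sum_(k < N) mass `[gate_left k, 1 - gate_left k]%classic =
    mass `[0, 2^-1]%classic - mass `[0, iter N (left_pre b) 2^-1]%classic.
  elim: N => [|N IH]; first by rewrite big_ord0 subrr.
  rewrite big_ord_recr/= IH.
  have := mass_near0 (iter N (left_pre b) 2^-1); rewrite -iterS -/(gate_left N) => ->.
    by rewrite -/(gate_left N); ring.
  by have := iter_left_pre_itv N; lra.
rewrite -[leRHS]mass01 lerBlDr; apply: (@le_trans _ _ (mass `[0, 1]%classic)).
  by apply: mass_mono => // x /=; rewrite !in_itv/=; lra.
by rewrite lerDl mass_ge0.
Qed.

End acip.

Section escape.
Context {R : realType}.

Lemma harmonic_unbounded (M : R) : exists N, M <= \sum_(k < N) k.+1%:R^-1 :> R.
Proof.
apply: contrapT => /forallNP h; apply: (@dvg_harmonic R).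
apply: nondecreasing_is_cvgn.
  apply/nondecreasing_seqP => n; rewrite /series/= big_nat_recr//= lerDl.
  by rewrite /harmonic/= invr_ge0 ler0n.
exists M => _ [n _ <-]; apply/ltW; rewrite ltNge; apply/negP => Mn.
by apply: (h n); move: Mn; rewrite /series/= big_mkord.
Qed.

Section fixed_parameter.
Variables (b : R) (mu : probability (measurableTypeR R) R).
Hypotheses (b_gt0 : 0 < b) (b_le1 : b <= 1).
Hypothesis acip_mu : is_acip (flat_map b) mu.

(** A left preimage is at least 1/48 of the point, so [a_k] decreases at most
    geometrically. *)
Lemma ln_iter_left_pre k : - ln (iter k (left_pre b) 2^-1) <= 48 * k.+1%:R.
Proof.
elim: k => [|k IH].
  by rewrite /= lnV ?posrE// opprK; have := ln2_le1 (R:=R); lra.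
have /andP[a0 a1] := iter_left_pre_itv b b_gt0 b_le1 k.
have /andP[a'0 a'1] := iter_left_pre_itv b b_gt0 b_le1 k.+1.
have h : iter k (left_pre b) 2^-1 <= 48 * iter k.+1 (left_pre b) 2^-1.
  by apply: left_pre_ge_lin => //; lra.
have h2 : ln (iter k (left_pre b) 2^-1) <= ln (48 * iter k.+1 (left_pre b) 2^-1).
  by rewrite ler_ln ?posrE//; lra.
have h3 : ln 48 <= 47 :> R.
  have -> : 48 = 1 + 47 :> R by ring.
  by apply: le_ln1Dx; lra.
move: h2; rewrite lnM ?posrE// -natr1; lra.
Qed.

Lemma gate_left_ge k : 96^-1 <= gate_left b k.
Proof.
have /andP[a0 a1] := iter_left_pre_itv b b_gt0 b_le1 k.+1.
have : 1 - iter k.+1 (left_pre b) 2^-1 <= 48 * gate_left b k.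
  by apply: left_pre_ge_lin => //; lra.
lra.
Qed.

(** The [k]-th gate ends where [- ln (1 - f_b) = - ln a_(k+1)], which grows at
    most linearly in [k], and [left_pre_gap] turns this into a harmonic lower
    bound for its width.  The hypothesis on [b] makes that bound available for
    all [k < N]. *)
Lemma gate_width N k : (1 - b) * (48 * N.+1%:R) <= ln 2 -> (k < N)%N ->
  (800 * k.+1%:R)^-1 <= 2^-1 - gate_left b k.
Proof.
move=> hb kN.
have /andP[a0 a1] := iter_left_pre_itv b b_gt0 b_le1 k.+1.
have L := ln_iter_left_pre k.+1.
have kN' : k.+2%:R <= N.+1%:R :> R by rewrite ler_nat.
have b1 : 0 <= 1 - b by rewrite subr_ge0.
have := left_pre_gap b b_gt0 b_le1 (1 - iter k.+1 (left_pre b) 2^-1).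
rewrite subKr -/(gate_left b k) => h.
apply: le_trans (h _ _); [|by lra|].
  have la : ln (iter k.+1 (left_pre b) 2^-1) <= 0 by apply: ln_le0; lra.
  have k1 : 1 <= k.+1%:R :> R by rewrite ler1n.
  have kE : k.+2%:R = k.+1%:R + 1 :> R by rewrite natr1.
  rewrite kE in L.
  by rewrite lef_pV2 ?posrE; lra.
rewrite -mulrN; apply: le_trans hb; apply: ler_wpM2l => //.
apply: (le_trans L); lra.
Qed.

(** Each gate has mass at least a constant times its width times the mass of
    [[eps, 1 - eps]], and all gates together have mass at most 1.  The bound
    [eps <= 96^-1] makes [[eps, 1 - eps]] contain the gates. *)
Lemma mass_middle_le (eps : R) N : 0 < eps -> eps <= 96^-1 ->
  (1 - b) * (48 * N.+1%:R) <= ln 2 ->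
  mass mu `[eps, 1 - eps]%classic * \sum_(k < N) k.+1%:R^-1 <=
  400 * expR (8 * (logit (1 - eps) - logit eps)).
Proof.
move=> e0 e1 hb; set Q := expR _; have Q0 : 0 < Q by exact: expR_gt0.
set m := mass _ _; have m0 : 0 <= m by exact: mass_ge0.
have gate k : (k < N)%N -> m * k.+1%:R^-1 <=
    400 * Q * mass mu `[gate_left b k, 1 - gate_left b k]%classic.
  move=> kN; have w := gate_width N k hb kN.
  have g1 := gate_left_ge k.
  have k0 : 0 < k.+1%:R :> R by rewrite ltr0n.
  have w0 : 0 < (800 * k.+1%:R : R)^-1 by rewrite invr_gt0; lra.
  have g2 : gate_left b k < 2^-1 by rewrite -subr_gt0; exact: lt_le_trans w0 w.
  set I := mass mu _; have I0 : 0 <= I by exact: mass_ge0.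
  have H : (1 - gate_left b k - gate_left b k) * m <= Q * (1 - eps - eps) * I.
    by apply: (mass_harnack b mu b_gt0 b_le1 acip_mu) => //; lra.
  have h1 : (800 * k.+1%:R)^-1 * m <= (2^-1 - gate_left b k) * m by exact: ler_wpM2r.
  have h2 (K : R) : 0 < K -> (800 * K)^-1 * m = m * K^-1 / 800.
    by move=> K0; field; exact: lt0r_neq0.
  have h3 : Q * (1 - eps - eps) * I <= Q * I.
    by rewrite -mulrA ler_pM2l// -[leRHS]mul1r ler_wpM2r//; lra.
  move: h1; rewrite h2//; move: (k.+1%:R^-1) => K; lra.
rewrite mulr_sumr.
apply: (@le_trans _ _ (\sum_(k < N) 400 * Q * mass mu `[gate_left b k, 1 - gate_left b k]%classic)).
  by apply: ler_sum => k _; exact: gate.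
have Q400 : 0 <= 400 * Q by lra.
have := ler_wpM2l Q400 (sum_mass_gates b mu b_gt0 b_le1 acip_mu N).
by rewrite mulr_sumr mulr1.
Qed.

(** Points near 1 come from points near 1/2, so [[1 - eps, 1]] has the mass of
    a subset of [[eps, 1 - eps]]. *)
Lemma mass_tail_le (eps : R) : 0 < eps -> eps <= 96^-1 ->
  mass mu `[eps, 1]%classic <= 2 * mass mu `[eps, 1 - eps]%classic.
Proof.
move=> e0 e1.
have mI (c d : R) : measurable (`[c, d]%classic : set (measurableTypeR R)) by exact: measurable_itv.
have mO : measurable (`]1 - eps, 1]%classic : set (measurableTypeR R)) by exact: measurable_itv.
have -> : `[eps, 1]%classic = `[eps, 1 - eps] `|` `]1 - eps, 1]%classic :> set R.
  apply/seteqP; split=> x /=; rewrite !in_itv/=; last by case; lra.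
  by have [h|h] := leP x (1 - eps) => xI; [left|right]; lra.
rewrite massU//; last first.
  by apply/disj_setPS => x [] /=; rewrite !in_itv/=; lra.
have : mass mu `]1 - eps, 1]%classic <= mass mu `[eps, 1 - eps]%classic; last by lra.
apply: (@le_trans _ _ (mass mu `[1 - eps, 1]%classic)).
  by apply: mass_mono => // x /=; rewrite !in_itv/=; lra.
rewrite (mass_near1 b mu b_gt0 b_le1 acip_mu); last by lra.
have p : 1 - eps <= 48 * left_pre b (1 - eps) by apply: left_pre_ge_lin => //; lra.
by apply: mass_mono => // x /=; rewrite !in_itv/=; lra.
Qed.

End fixed_parameter.

(** * Weak convergence *)

Lemma integral_near_dirac (mu : probability (measurableTypeR R) R) (phi : R -> R) (eps w M : R) :
  supported_on `[0, 1] mu ->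
  {within `[0, 1], continuous phi} -> 0 < eps -> eps < 1 ->
  (forall x, 0 <= x < eps -> `|phi x - phi 0| <= w) ->
  (forall x, 0 <= x <= 1 -> `|phi x - phi 0| <= M) ->
  `|phi 0 - \int[mu]_(x in `[0, 1]) phi x| <= w + M * fine (mu `[eps, 1]%classic).
Proof.
rewrite /supported_on => mu1 cphi e0 e1 hw hM.
have m01 : measurable (`[0, 1]%classic : set (measurableTypeR R)) by exact: measurable_itv.
have mphi : measurable_fun (`[0, 1]%classic : set (measurableTypeR R)) phi.
  by apply: subspace_continuous_measurable_fun.
have icst A (r : R) : measurable A -> mu.-integrable A (EFin \o cst r).
  by move=> mA; exact: finite_measure_integrable_cst.
have iphi : mu.-integrable (`[0, 1]%classic : set (measurableTypeR R)) (EFin \o phi).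
  apply: measurable_bounded_integrable => //; first by rewrite ltey_eq fin_num_measure.
  exists (`|phi 0| + M); split; first exact: num_real.
  move=> y hy x; rewrite /= in_itv/= => /hM h; apply/ltW/(le_lt_trans _ hy).
  have := ler_normD (phi x - phi 0) (phi 0); rewrite subrK; lra.
rewrite distrC.
pose dev (x : R) := phi x - phi 0.
have i0 : mu.-integrable (`[0, 1]%classic : set (measurableTypeR R)) (EFin \o dev).
  exact: (@integrableB _ _ _ mu _ m01 (EFin \o phi) (EFin \o cst (phi 0)) iphi (icst _ _ m01)).
have -> : \int[mu]_(x in `[0, 1]) phi x - phi 0 = \int[mu]_(x in `[0, 1]) dev x.
  rewrite (@RintegralB _ _ _ mu _ phi (cst (phi 0)) m01 iphi (icst _ _ m01)).
  rewrite Rintegral_cst// [fine _](_ : _ = 1) ?mulr1//.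
  by rewrite -[RHS]/(fine 1%E); congr fine; exact: mu1.
have mA : measurable (`[0, eps[%classic : set (measurableTypeR R)) by exact: measurable_itv.
have mB : measurable (`[eps, 1]%classic : set (measurableTypeR R)) by exact: measurable_itv.
apply: le_trans (le_normr_Rintegral m01 i0) _.
have in0 := integrable_norm i0.
have E01 : `[0, 1]%classic = `[0, eps[ `|` `[eps, 1]%classic :> set R.
  apply/seteqP; split=> x /=; rewrite !in_itv/=; last by case; lra.
  by have [h|h] := ltP x eps => xI; [left|right]; lra.
have inA : mu.-integrable (`[0, eps[%classic : set (measurableTypeR R)) (EFin \o (fun x => `|dev x|)).
  by apply: integrableS in0 => //; rewrite E01; exact: subsetUl.
have inB : mu.-integrable (`[eps, 1]%classic : set (measurableTypeR R)) (EFin \o (fun x => `|dev x|)).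
  by apply: integrableS in0 => //; rewrite E01; exact: subsetUr.
have -> : \int[mu]_(x in `[0, 1]) `|dev x| =
   \int[mu]_(x in `[0, eps[) `|dev x| + \int[mu]_(x in `[eps, 1]) `|dev x|.
  rewrite {1}E01 (@Rintegral_setU _ _ _ mu _ _ (fun x => `|dev x|))//; first by rewrite -E01.
  by apply/disj_setPS => x [] /=; rewrite !in_itv/=; lra.
apply: lerD.
- apply: (@le_trans _ _ (\int[mu]_(x in `[0, eps[) w)).
    apply: (@le_Rintegral _ _ _ mu _ (fun x => `|dev x|) (cst w)) => //; first exact: icst.
  rewrite Rintegral_cst//; apply: ler_piMr.
    by apply: le_trans (hw 0 _) => //; lra.
  rewrite -lee_fin fineK ?probability_le1//; exact: fin_num_measure.
- apply: (@le_trans _ _ (\int[mu]_(x in `[eps, 1]) M)).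
    apply: (@le_Rintegral _ _ _ mu _ (fun x => `|dev x|) (cst M)) => //; first exact: icst.
    by move=> x /=; rewrite in_itv/= => xI; apply: hM; lra.
  by rewrite Rintegral_cst.
Qed.

End escape.

Theorem proposition4p11 (R : realType)
    (mu : R -> probability (measurableTypeR R) R)
    (acip_mu : forall b : R, (Num.sqrt 6)^-1 <= b < 1 ->
       is_acip (flat_map b) (mu b)) :
  weakly_cvg01 1^'- mu \d_(0 : measurableTypeR R).
Proof.
move=> phi cphi.
have m01 : measurable (`[0, 1]%classic : set (measurableTypeR R)) by exact: measurable_itv.
have mphi : measurable_fun (`[0, 1]%classic : set (measurableTypeR R)) phi.
  by apply: subspace_continuous_measurable_fun.
have -> : \int[\d_(0 : measurableTypeR R)]_(x in `[0, 1]) phi x = phi 0.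
  rewrite /Rintegral integral_dirac//; last exact/measurable_EFinP.
  by rewrite diracE mem_set ?mul1e//= in_itv/= lexx ler01.
apply/cvgrPdist_le => e e0.
have e20 : 0 < e / 2 by lra.
have [M M0 hM] : exists2 M, 0 < M & forall x, 0 <= x <= 1 -> `|phi x - phi 0| <= M.
  have /compact_bounded[M [_ Mb]] := continuous_compact cphi (@segment_compact R 0 1).
  have hb x : 0 <= x <= 1 -> `|phi x| <= `|M| + 1.
    move=> xI; apply: (Mb (`|M| + 1)); first by rewrite ltr_pwDr// ler_norm.
    by exists x => //=; rewrite in_itv.
  exists (2 * (`|M| + 1)); first by have := normr_ge0 M; lra.
  move=> x xI; have := ler_normB (phi x) (phi 0).
  by have := hb x xI; have := hb 0; rewrite lexx ler01 => /(_ isT); lra.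
have [eps [eps0 eps1 heps]] : exists eps, [/\ 0 < eps, eps <= 96^-1 &
    forall x, 0 <= x < eps -> `|phi x - phi 0| <= e / 2].
  have /(continuous_within_itvP _ ltr01)[_ c0 _] := cphi.
  move/cvgrPdist_le : c0 => /(_ _ e20); rewrite near_withinE.
  move=> /nbhs_ballP[r /= r0 hr].
  exists (Num.min r 96^-1); split; first by rewrite lt_min r0 invr_gt0 ltr0n.
    by rewrite ge_min lexx orbT.
  move=> x /andP[x0]; rewrite lt_min => /andP[xr _].
  move: x0; rewrite le_eqVlt => /predU1P[<-|x0]; first by rewrite subrr normr0 ltW.
  rewrite distrC; apply: hr => //.
  by rewrite /ball/= sub0r normrN gtr0_norm.
pose Q : R := expR (8 * (logit (1 - eps) - logit eps)).
have Q0 : 0 < Q by exact: expR_gt0.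
(* N makes mass_middle_le bound the mass of [eps, 1 - eps] by e / (4 * M) *)
have [N hN] := @harmonic_unbounded R (400 * Q * (4 * M) / e).
have N0 : 0 < 48 * N.+1%:R :> R by rewrite mulr_gt0// ltr0n.
have d0 : 0 < ln 2 / (48 * N.+1%:R) :> R by rewrite divr_gt0// ln2_gt0.
near=> b.
have b1 : b < 1 by near: b; exact: nbhs_left_lt.
have b2 : 2^-1 <= b by near: b; apply: nbhs_left_ge; lra.
have bN : (1 - b) * (48 * N.+1%:R) <= ln 2.
  rewrite -ler_pdivlMr// lerBlDr addrC -lerBlDr.
  by near: b; apply: nbhs_left_ge; rewrite ltrBlDr ltrDl.
have b_gt0 : 0 < b by lra.
have acip : is_acip (flat_map b) (mu b).
  (* 6 >= 2 ^ 2, so 1 / sqrt 6 <= 1 / 2 *)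
  apply: acip_mu; rewrite b1 andbT; apply: le_trans b2.
  rewrite lef_pV2 ?posrE ?sqrtr_gt0// -(@ler_pXn2r _ 2)// ?nnegrE ?sqrtr_ge0//.
  by rewrite sqr_sqrtr//; lra.
have mid := mass_middle_le b (mu b) b_gt0 (ltW b1) acip eps N eps0 eps1 bN.
have tail := mass_tail_le b (mu b) b_gt0 (ltW b1) acip eps eps0 eps1.
have m0 := mass_ge0 (mu b) `[eps, 1 - eps]%classic.
have [mu1 _ _] := acip.
have eps_lt1 : eps < 1 by lra.
apply: le_trans (integral_near_dirac (mu b) phi eps _ _ mu1 cphi eps0 eps_lt1 heps hM) _.
rewrite -/(mass (mu b) `[eps, 1]%classic).
set m := mass (mu b) `[eps, 1 - eps]%classic in mid tail m0.
have h1 : m * (400 * Q * (4 * M) / e) <= 400 * Q.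
  by apply: le_trans mid; apply: ler_wpM2l.
have h2 : m * (4 * M) <= e.
  have p : 0 < 400 * Q / e by apply: divr_gt0 => //; lra.
  rewrite -(ler_pM2l p); have -> : 400 * Q / e * e = 400 * Q by field; lra.
  by have -> : 400 * Q / e * (m * (4 * M)) = m * (400 * Q * (4 * M) / e) by field; lra.
have := ler_wpM2l (ltW M0) tail; lra.
Unshelve. all: by end_near.
Qed.
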